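(* Let $\mu_0\in\mathcal P^0_\Upsilon(\mathbb R)$ and let $(\mu_t)_{t\ge0}$ be a measure weak solution to the dissipative Boltzmann equation associated to $\mu_0$. For any $\gamma>1$ and $s\in(0,1]$ one has $$M_s(\mu_t)\ge\frac{M_s(\mu_0)}{\Big(1+C_{\gamma,s}A_s^{1-\frac s\gamma}\,\frac\gamma s\,M_s(\mu_0)^{\frac\gamma s}\,t\Big)^{\frac s\gamma}}\qquad\forall t\ge0,$$ where $C_{\gamma,s}$ depends only on $\gamma$ and $s$, and $A_s$ is any constant such that $$A_s\ge\max\left\{\tilde C_{\gamma,s},\ \frac{M_{s+\gamma}(\mu_0)}{M_s(\mu_0)^{1+\frac\gamma s}}\right\},$$ with $\tilde C_{\gamma,s}$ a constant depending only on $\gamma$ and $s$. Moreover, it holds $$M_k(\mu_t)\ge\frac{M_s(\mu_0)^{\frac ks}}{\Big(1+C_{\gamma,s}A_s^{1-\frac s\gamma}\,\frac\gamma s\,M_s(\mu_0)^{\frac\gamma s}\,t\Big)^{\frac k\gamma}}\qquad\forall\,k>1,\ s\in(0,1],\ t\ge0.$$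
   Context: $a\in(0,1)$ is fixed throughout (so constants may also depend on $a$), $b=1-a$, $\gamma$ is the exponent in the collision operator below, and $\Upsilon=\max(\gamma,2)$. $M_p(\mu)=\int_{\mathbb R}|x|^p\mu(dx)$. For $s\ge0$, $\|\mu\|_s:=\int_{\mathbb R}(1+x^2)^{s/2}|\mu|(dx)$; $\mathcal M_s^+(\mathbb R)$ is the set of nonnegative Borel measures on $\mathbb R$ with $\|\mu\|_s<\infty$. $\mathcal P_k^0(\mathbb R)$ is the set of Borel probability measures $\mu$ on $\mathbb R$ with $M_k(\mu)<\infty$ and $\int x\,\mu(dx)=0$. Collision operator: $\langle\mathcal Q(\mu,\nu);\varphi\rangle:=\frac12\int_{\mathbb R^2}|x-y|^\gamma\big(\varphi(ax+by)+\varphi(bx+ay)-\varphi(x)-\varphi(y)\big)\mu(dx)\nu(dy)$. Measure weak solution: given $\mu_0\in\mathcal M^+_\Upsilon(\mathbb R)$, a family $(\mu_t)_{t\ge0}\subset\mathcal M^+_\Upsilon(\mathbb R)$ is a measure weak solution to the dissipative Boltzmann equation $\partial_t\mu_t=\mathcal Q(\mu_t,\mu_t)$ associated to $\mu_0$ if: (1) $\sup_{t\ge0}\|\mu_t\|_\Upsilon\le\|\mu_0\|_\Upsilon$, and $\int\mu_t(dx)=\int\mu_0(dx)$, $\int x\,\mu_t(dx)=\int x\,\mu_0(dx)$ for all $t>0$; (2) for every bounded continuous $\varphi$ on $\mathbb R$, the map $t\mapsto\langle\mathcal Q(\mu_t,\mu_t);\varphi\rangle$ belongs to $C([0,\infty))\cap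 L^1_{\rm loc}([0,\infty))$ and, for all $t\ge0$, $\int\varphi\,d\mu_t=\int\varphi\,d\mu_0+\int_0^t\langle\mathcal Q(\mu_\tau,\mu_\tau);\varphi\rangle\,d\tau$. *)

(* Defs.v *)
From HB Require Import structures.
From mathcomp Require Import all_boot all_order all_algebra.
From mathcomp Require Import all_classical all_reals all_analysis.

Set Implicit Arguments.
Unset Strict Implicit.
Unset Printing Implicit Defensive.

Import Order.TTheory GRing.Theory Num.Theory.
Import numFieldNormedType.Exports.

Local Open Scope classical_set_scope.
Local Open Scope ring_scope.

(* Finite nonnegative Borel measures on the real line: every measure of the
   spaces M_s^+ and P_k^0 below is finite, and finiteness makes the product
   measure of the collision operator available. *)
Notation borel_measure R :=
  {finite_measure set (measurableTypeR R) -> \bar R}.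

Definition Upsilon {R : realType} (gamma : R) : R := Num.max gamma 2.

(* Moments take values in [0, +oo]. *)
Definition moment {R : realType} (p : R) (mu : borel_measure R) : \bar R :=
  (\int[mu]_x (`|x| `^ p)%:E)%E.

(* The measures are nonnegative, so |mu| = mu. *)
Definition weighted_norm {R : realType} (s : R) (mu : borel_measure R) :
    \bar R :=
  (\int[mu]_x ((1 + x ^+ 2) `^ (s / 2))%:E)%E.

Definition in_Mplus {R : realType} (s : R) (mu : borel_measure R) : Prop :=
  (weighted_norm s mu < +oo)%E.

Definition in_P0 {R : realType} (k : R) (mu : borel_measure R) : Prop :=
  [/\ mu setT = 1%E, (moment k mu < +oo)%E & (\int[mu]_x x%:E)%E = 0%E].

(* For bounded phi and mu, nu in M_gamma^+ the integrand is integrable, so the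
   real-valued integral is the genuine one. *)
Definition collision {R : realType} (a gamma : R) (mu nu : borel_measure R)
    (phi : R -> R) : R :=
  let b := 1 - a in
  2^-1 * \int[(mu \x nu)%E]_z
    (`|z.1 - z.2| `^ gamma *
     (phi (a * z.1 + b * z.2) + phi (b * z.1 + a * z.2) - phi z.1 - phi z.2)).

(* The library predicate locally_integrable asks for an open domain, hence the
   explicit quantification over the compact subsets of [0, +oo[. *)
Definition L1loc_nonneg {R : realType} (f : R -> R) : Prop :=
  forall K : set R, K `<=` `[0, +oo[ -> compact K ->
    (@lebesgue_measure R).-integrable K (EFin \o f).

(* The family mu is only constrained at nonnegative times. *)
Definition measure_weak_solution {R : realType} (a gamma : R)
    (mu0 : borel_measure R) (mu : R -> borel_measure R) : Prop :=
  [/\ in_Mplus (Upsilon gamma) mu0 /\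
      (forall t : R, 0 <= t -> in_Mplus (Upsilon gamma) (mu t)),
      (ereal_sup [set weighted_norm (Upsilon gamma) (mu t)
                 | t in `[0%R, +oo[%classic]
        <= weighted_norm (Upsilon gamma) mu0)%E,
      (forall t : R, 0 < t ->
        mu t setT = mu0 setT /\
        (\int[mu t]_x x%:E)%E = (\int[mu0]_x x%:E)%E) &
      (forall phi : R -> R, continuous phi -> [bounded phi x | x in setT] ->
        let Q := fun t => collision a gamma (mu t) (mu t) phi in
        [/\ {within `[0, +oo[, continuous Q},
            L1loc_nonneg Q &
            forall t : R, 0 <= t ->
              \int[mu t]_x phi x =
              \int[mu0]_x phi x + \int[@lebesgue_measure R]_(tau in `[0, t]) Q tau])].

(* Main.v *)
Require Import Defs.
From HB Require Import structures.
From mathcomp Require Import all_boot all_order all_algebra.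
From mathcomp Require Import all_classical all_reals all_analysis.
From mathcomp Require Import measurable_realfun ring lra.
Set Implicit Arguments.
Unset Strict Implicit.
Unset Printing Implicit Defensive.

Import Order.TTheory GRing.Theory Num.Theory.
Import numFieldNormedType.Exports.

Local Open Scope classical_set_scope.
Local Open Scope ring_scope.

(** Write p = gamma / s, f(t) for the moment of order s of mu_t and M_gamma for
    its moment of order gamma.  When two particles collide, the larger one is
    split into two pieces; since r^s is concave this tends to increase the
    moment of order s, and the only possible loss comes from cancellation with
    the smaller particle.  This holds for every nonnegative nondecreasing
    weight g for which g r / r is nonincreasing: a collision of x and y with
    |y| <= |x| changes the total weight by at least
      gain g |x| - 3 g |y|,  gain g r = g (a r) + g ((1 - a) r) - g r >= 0.
    Multiplying by the collision rate and integrating (collision_lb),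
      d/dt I_g >= c P_g - C M_gamma I_g,
    where I_g is the average of g |x| and P_g that of gain g |x| |x|^gamma.

    The production P_g controls the large particles occurring in M_gamma.  For
    the truncation T_L r = min(r, L)^s the gain equals L^s beyond a fixed
    multiple of L, so M_gamma is bounded by a term living on sizes below that
    multiple plus L^(-s) P_g.  When I_g is small compared with L^s the
    production absorbs the second term, and I_g decreases at a rate governed by
    the bounded sizes only (collision_ge_controlled).  All the weights are
    bounded, hence admissible in the weak formulation, and every term of the
    estimate is finite as soon as M_gamma is.

    Two consequences give the theorem.
    - moment_persistence: with T_L + T_n, L^s proportional to m and n large, a
      moment which exceeds m at some time stays above m / 4 during a time of
      order m^(-p).  Taking m as small as the elapsed time demands gives the
      decay rate t^(-1/p), up to a constant factor.
    - moment_short_time: for times small compared with f(0)^(-p),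
        f(t) >= f(0) (1 - C B t) as soon as M_gamma(mu_0) <= B.
    The hypothesis on A and the interpolation of the order gamma between s and
    s + gamma allow B to be twice b = A^(1 - s / gamma) f(0)^p, and b >= f(0)^p
    because A >= 1.  Hence for C b t small the second estimate is stronger than
    the claim, by a tangent inequality for w^(-1/p), and for C b t large the
    first one is (moment_lower_bound).  The bound on M_k follows from Jensen's
    inequality M_k >= M_s^(k / s). *)

(** * Powers and radial profiles *)

Section RealPowers.
Context {R : realType}.
Implicit Types x y u v p : R.

Lemma ler_powR_base p x y : 0 <= p -> 0 <= x -> x <= y -> x `^ p <= y `^ p.
Proof.
move=> p0 x0 xy; apply: ge0_ler_powR => //; rewrite nnegrE //.
exact: le_trans xy.
Qed.

(** Young's inequality for the conjugate exponents p and p / (p - 1), applied to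
    u and to the power p - 1 of v: a convex power lies above its tangents.  *)
Lemma powR_tangent p u v : 1 < p -> 0 <= u -> 0 <= v ->
  p * v `^ (p - 1) * u - (p - 1) * v `^ p <= u `^ p.
Proof.
move=> p1 u0 v0.
have p0 : 0 < p by lra.
have p10 : 0 < p - 1 by lra.
have q0 : 0 < p / (p - 1) by rewrite divr_gt0.
have pq : p^-1 + (p / (p - 1))^-1 = 1 by field; lra.
have := @conjugate_powR R u (v `^ (p - 1)) p (p / (p - 1))
  u0 (powR_ge0 _ _) p0 q0 pq.
rewrite -powRrM (_ : (p - 1) * (p / (p - 1)) = p); last by field; lra.
rewrite -(ler_pM2l p0) mulrDr => H.
have e1 : p * (u `^ p / p) = u `^ p by field; lra.
have e2 : p * (v `^ p / (p / (p - 1))) = (p - 1) * v `^ p by field; lra.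
rewrite e1 e2 in H.
rewrite lerBlDr -mulrA [v `^ _ * u]mulrC; exact: H.
Qed.

Lemma continuous_powR_norm p : 0 < p -> continuous (fun x : R => `|x| `^ p).
Proof.
move=> p0 x; have [->|x0] := eqVneq x 0.
  apply/cvgrPdist_lt => e e0 /=.
  have d0 : 0 < e `^ p^-1 by rewrite powR_gt0.
  rewrite normr0 powR0 ?gt_eqF//.
  exists (e `^ p^-1) => //= y /=; rewrite !sub0r !normrN => ye.
  rewrite ger0_norm ?powR_ge0//.
  rewrite -[ltRHS](powRr1 (ltW e0)) -(mulVf (lt0r_neq0 p0)) powRrM.
  by apply: gt0_ltr_powR => //; rewrite ?nnegrE// ?powR_ge0.
have := @derivable_powR R 1 p `|x|.
rewrite in_itv/= andbT normr_gt0 => /(_ x0) /derivable1_diffP.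
move=> /differentiable_continuous H.
have N : {for x, continuous (fun y : R => `|y|)} by exact: norm_continuous.
exact: (cvg_comp _ _ N H).
Qed.

End RealPowers.

Section Profiles.
Context {R : realType}.
Implicit Types (g h : R -> R) (x y r l p : R).

(** The third clause says that g r / r is nonincreasing.  With monotonicity this
    is what the collision estimates use of concavity, and it passes to
    truncations and sums without any regularity of g. *)
Definition profile g :=
  [/\ forall r, 0 <= r -> 0 <= g r,
      forall r1 r2, 0 <= r1 -> r1 <= r2 -> g r1 <= g r2 &
      forall l r, 0 <= l -> l <= 1 -> 0 <= r -> l * g r <= g (l * r)].

Lemma profileD g h : profile g -> profile h -> profile (g \+ h).
Proof.
move=> [g0 gm gs] [h0 hm hs]; split=> [r r0|r1 r2 r10 r12|l r l0 l1 r0] /=.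
- by rewrite addr_ge0 ?g0 ?h0.
- by rewrite lerD ?gm ?hm.
- by rewrite mulrDr lerD ?gs ?hs.
Qed.

Lemma profileZ c g : 0 <= c -> profile g -> profile (fun r => c * g r).
Proof.
move=> c0 [g0 gm gs]; split=> [r r0|r1 r2 r10 r12|l r l0 l1 r0] /=.
- by rewrite mulr_ge0 ?g0.
- by rewrite ler_wpM2l ?gm.
- by rewrite mulrCA ler_wpM2l ?gs.
Qed.

Lemma profile_subadd g x y : profile g -> 0 <= x -> 0 <= y ->
  g (x + y) <= g x + g y.
Proof.
move=> [g0 gm gs] x0 y0; have [xy|xy] := eqVneq (x + y) 0.
  by rewrite xy -[leLHS]addr0; apply: lerD; [exact: gm|exact: g0].
have xy0 : 0 < x + y by rewrite lt0r xy addr_ge0.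
have H1 : x / (x + y) * g (x + y) <= g x.
  rewrite -[in leRHS](divfK xy x). apply: gs; last exact: ltW.
    by apply: divr_ge0 => //; exact: ltW.
  by rewrite ler_pdivrMr// mul1r lerDl.
have H2 : y / (x + y) * g (x + y) <= g y.
  rewrite -[in leRHS](divfK xy y); apply: gs; last exact: ltW.
    by apply: divr_ge0 => //; exact: ltW.
  by rewrite ler_pdivrMr// mul1r lerDr.
have -> : g (x + y) = x / (x + y) * g (x + y) + y / (x + y) * g (x + y).
  by rewrite -mulrDl -mulrDl divff// mul1r.
exact: lerD.
Qed.

Lemma profile_double g x : profile g -> 0 <= x -> g (2 * x) <= 2 * g x.
Proof.
by move=> pg x0; rewrite mulr_natl mulr2n mulr_natl mulr2n profile_subadd.
Qed.

End Profiles.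

Section PointwiseEstimate.
Context {R : realType} (a : R).
Implicit Types (g : R -> R) (x y r : R).

(** Variation of the total weight when a particle of size r meets a particle
    located at the origin, so that it splits into the sizes a r and
    (1 - a) r. *)
Definition gain g r := g (a * r) + g ((1 - a) * r) - g r.

Definition collision_increment (phi : R -> R) x y :=
  phi (a * x + (1 - a) * y) + phi ((1 - a) * x + a * y) - phi x - phi y.

Lemma gain_ge0 g r : 0 < a -> a < 1 -> profile g -> 0 <= r -> 0 <= gain g r.
Proof.
move=> a0 a1 [g0 gm gs] r0; rewrite /gain subr_ge0.
have -> : g r = a * g r + (1 - a) * g r by ring.
by apply: lerD; apply: gs => //; lra.
Qed.

Lemma gain_le g r : 0 < a -> a < 1 -> profile g -> 0 <= r -> gain g r <= g r.
Proof.
move=> a0 a1 [g0 gm gs] r0; rewrite /gain lerBlDr; apply: lerD; apply: gm.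
- by rewrite mulr_ge0// ltW.
- by rewrite ler_piMl// ltW.
- by rewrite mulr_ge0//; lra.
- by rewrite ler_piMl//; lra.
Qed.

(** Since a |x| <= |a x + (1 - a) y| + (1 - a) |y|, subadditivity compares the
    two outgoing weights with g (a |x|) and g ((1 - a) |x|), each up to g |y|;
    the weight of the incoming y is the third loss. *)
Lemma collision_increment_lb g x y : 0 < a -> a < 1 -> profile g ->
  gain g `|x| - 3 * g `|y| <= collision_increment (fun z => g `|z|) x y.
Proof.
move=> a0 a1 pg; have [g0 gm gs] := pg; rewrite /collision_increment /gain.
have key l k : 0 <= l -> 0 <= k -> k <= 1 ->
    g (l * `|x|) <= g `|l * x + k * y| + g `|y|.
  move=> l0 k0 k1; apply: (@le_trans _ _ (g (`|l * x + k * y| + k * `|y|))).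
    apply: gm; first by rewrite mulr_ge0.
    rewrite -{1}(ger0_norm l0) -{2}(ger0_norm k0) -!normrM.
    by rewrite -{1}[l * x](addrK (k * y)) ler_normB.
  apply: (le_trans (profile_subadd pg (normr_ge0 _) (mulr_ge0 k0 (normr_ge0 _)))).
  by rewrite lerD2l; apply: gm; rewrite ?mulr_ge0// ler_piMl.
have h1 : g (a * `|x|) <= g `|a * x + (1 - a) * y| + g `|y| by apply: key; lra.
have h2 : g ((1 - a) * `|x|) <= g `|(1 - a) * x + a * y| + g `|y|.
  by apply: key; lra.
lra.
Qed.

(** By symmetry |y| <= |x|.  If 2 |y| <= |x| the rate |x - y|^gamma is comparable
    with |x|^gamma and the gain of x survives.  Otherwise the gain of x is at
    most g |x| <= 2 g |y| and disappears into the loss. *)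
Lemma weighted_increment_lb gamma g x y : 0 < a -> a < 1 -> 0 < gamma -> profile g ->
  2 `^ (- gamma) * (gain g `|x| * `|x| `^ gamma + gain g `|y| * `|y| `^ gamma)
    - 6 * 2 `^ gamma * (`|x| `^ gamma * g `|y| + g `|x| * `|y| `^ gamma)
  <= `|x - y| `^ gamma * collision_increment (fun z => g `|z|) x y.
Proof.
move=> a0 a1 ga0 pg.
(* Both sides are symmetric in x and y, although not syntactically. *)
wlog yx : x y / `|y| <= `|x|.
  move=> H; have [yx|/ltW xy] := leP `|y| `|x|; first exact: H.
  have := H y x xy; rewrite distrC.
  have -> : collision_increment (fun z => g `|z|) y x =
            collision_increment (fun z => g `|z|) x y.
    rewrite /collision_increment [a * y + _]addrC [(1 - a) * y + _]addrC.
    by ring.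
  by apply: le_trans; rewrite le_eqVlt; apply/orP; left; apply/eqP; ring.
have [g0 gm gs] := pg.
have inc := collision_increment_lb x y a0 a1 pg.
set K := 2 `^ gamma; have K1 : 1 <= K.
  by rewrite -[leLHS](powRr0 2); apply: ler_powR; lra.
rewrite powRN -/K.
set d := `|x - y| `^ gamma; set X := `|x| `^ gamma; set Y := `|y| `^ gamma.
set G := collision_increment _ _ _ in inc *.
have px := gain_ge0 a0 a1 pg (normr_ge0 x).
have py := gain_ge0 a0 a1 pg (normr_ge0 y).
have px1 := gain_le a0 a1 pg (normr_ge0 x).
have py1 := gain_le a0 a1 pg (normr_ge0 y).
have gx0 := g0 _ (normr_ge0 x); have gy0 := g0 _ (normr_ge0 y).
have d0 : 0 <= d by rewrite powR_ge0.
have X0 : 0 <= X by rewrite powR_ge0.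
have Y0 : 0 <= Y by rewrite powR_ge0.
have YX : Y <= X by apply: ler_powR_base => //; exact: ltW.
have dX : d <= K * X.
  rewrite -powRM//; apply: ler_powR_base => //; first exact: ltW.
  by have := ler_normB x y; lra.
have Ki0 : 0 <= K^-1 by rewrite invr_ge0; lra.
have Ki1 : K^-1 <= 1 by rewrite invf_le1; lra.
set p := gain g `|x| in inc px px1 *; set q := gain g `|y| in py py1 *.
set u := g `|x| in gx0 px1 *; set v := g `|y| in inc gy0 py1 *.
have h1 : d * (p - 3 * v) <= d * G by rewrite ler_wpM2l.
have h2 : d * v <= K * X * v by rewrite ler_wpM2r.
have Xv0 : 0 <= X * v by rewrite mulr_ge0.
have h3 : K^-1 * (q * Y) <= K * (X * v).
  have : q * Y <= X * v by rewrite mulrC; apply: ler_pM.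
  have : K^-1 * (q * Y) <= q * Y by rewrite ler_piMl// mulr_ge0.
  have : X * v <= K * (X * v) by rewrite ler_peMl.
  by lra.
have uY0 : 0 <= K * (u * Y) by rewrite !mulr_ge0//; lra.
have [yx2|yx2] := leP (2 * `|y|) `|x|.
  have h4 : K^-1 * X <= d.
    rewrite -[K^-1]powRN -[2]invrK -powR_inv1 ?invr_ge0// -powRrM mulN1r opprK.
    rewrite -powRM ?invr_ge0//; apply: ler_powR_base; first exact: ltW.
      by rewrite mulr_ge0// invr_ge0.
    by have := lerB_dist x y; lra.
  have h5 : K^-1 * X * p <= d * p by rewrite ler_wpM2r.
  by nra.
have h4 : p <= 2 * v.
  rewrite (le_trans px1)// (@le_trans _ _ (g (2 * `|y|)))//.
    by apply: gm => //; exact: ltW.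
  exact: profile_double.
have h5 : K^-1 * (p * X) <= K * (2 * (X * v)).
  have : p * X <= 2 * (X * v) by rewrite mulrC mulrCA; apply: ler_wpM2l.
  have : K^-1 * (p * X) <= p * X by rewrite ler_piMl// mulr_ge0.
  have : 2 * (X * v) <= K * (2 * (X * v)) by rewrite ler_peMl// mulr_ge0.
  by lra.
have dp0 : 0 <= d * p by rewrite mulr_ge0.
by lra.
Qed.

End PointwiseEstimate.

(** * Truncated powers as test profiles *)

Section TruncatedPowers.
Context {R : realType}.
Implicit Types (g h : R -> R) (a s gamma L r l : R).

Definition test_profile g :=
  [/\ profile g, continuous (fun x : R => g `|x|) &
      exists M, forall r, 0 <= r -> g r <= M].

Lemma test_profileD g h : test_profile g -> test_profile h ->
  test_profile (g \+ h).
Proof.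
move=> [pg cg [M gM]] [ph ch [N hN]]; split; first exact: profileD.
- by move=> x; apply: cvgD; [exact: cg|exact: ch].
- by exists (M + N) => r r0 /=; rewrite lerD ?gM ?hN.
Qed.

Lemma test_profileZ c g : 0 <= c -> test_profile g ->
  test_profile (fun r => c * g r).
Proof.
move=> c0 [pg cg [M gM]]; split; first exact: profileZ.
- by move=> x; apply: cvgMr; exact: cg.
- by exists (c * M) => r r0; rewrite ler_wpM2l ?gM.
Qed.

Definition trunc_pow s L r := Num.min r L `^ s.

Lemma trunc_pow_le s L r : 0 < s -> 0 <= L -> 0 <= r ->
  trunc_pow s L r <= r `^ s.
Proof.
move=> s0 L0 r0; apply: ler_powR_base; first exact: ltW.
  by rewrite le_min r0.
by rewrite ge_min lexx.
Qed.

Lemma trunc_pow_ubound s L r : 0 < s -> 0 <= L -> 0 <= r ->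
  trunc_pow s L r <= L `^ s.
Proof.
move=> s0 L0 r0; apply: ler_powR_base; first exact: ltW.
  by rewrite le_min r0.
by rewrite ge_min lexx orbT.
Qed.

Lemma continuous_trunc_pow s L : 0 < s -> 0 <= L ->
  continuous (fun x : R => trunc_pow s L `|x|).
Proof.
move=> s0 L0.
have -> : (fun x : R => trunc_pow s L `|x|) =
    (fun y : R => `|y| `^ s) \o (fun x : R => Num.min `|x| L).
  apply/funext => x /=; have m0 : 0 <= Num.min `|x| L by rewrite le_min normr_ge0.
  by rewrite (ger0_norm m0).
move=> x; apply: continuous_comp; last exact: continuous_powR_norm.
apply: (@continuous_min _ _ (fun x : R => `|x|) (fun=> L)).
  exact: norm_continuous.
exact: cvg_cst.
Qed.

Lemma test_profile_trunc_pow s L : 0 < s -> s <= 1 -> 0 <= L ->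
  test_profile (trunc_pow s L).
Proof.
move=> s0 s1 L0; split; [split| |].
- by move=> r _; exact: powR_ge0.
- move=> r1 r2 r10 r12; apply: ler_powR_base; first exact: ltW.
    by rewrite le_min r10.
  by rewrite le_min !ge_min r12 lexx orbT.
- move=> l r l0 l1 r0; rewrite /trunc_pow.
  have m0 : 0 <= Num.min r L by rewrite le_min r0.
  apply: (@le_trans _ _ ((l * Num.min r L) `^ s)).
    rewrite powRM// ler_wpM2r ?powR_ge0//.
    have [->|ln0] := eqVneq l 0; first by rewrite powR_ge0.
    by apply: ger1_powR => //; rewrite lt0r ln0 l0.
  apply: ler_powR_base; [exact: ltW|exact: mulr_ge0|].
  rewrite le_min; apply/andP; split.
    by rewrite ler_wpM2l// ge_min lexx.
  apply: (@le_trans _ _ (1 * L)); last by rewrite mul1r.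
  by apply: ler_pM => //; rewrite ge_min lexx orbT.
- exact: continuous_trunc_pow.
- by exists (L `^ s) => r; exact: trunc_pow_ubound.
Qed.

(** Both pieces of a particle of size at least L / min(a, 1 - a) are still above
    the truncation level, so the splitting creates one full unit L^s. *)
Lemma gain_trunc_pow a s L r : 0 < a -> a < 1 -> 0 <= L ->
  L <= Num.min a (1 - a) * r -> gain a (trunc_pow s L) r = L `^ s.
Proof.
move=> a0 a1 L0 Lr; have m0 : 0 < Num.min a (1 - a) by rewrite lt_min a0; lra.
have r0 : 0 <= r by rewrite -(pmulr_rge0 r m0) (le_trans L0).
have La : L <= a * r by rewrite (le_trans Lr)// ler_wpM2r// ge_min lexx.
have Lb : L <= (1 - a) * r.
  by rewrite (le_trans Lr)// ler_wpM2r// ge_min lexx orbT.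
have Lr1 : L <= r by rewrite (le_trans La)// ler_piMl// ltW.
by rewrite /gain /trunc_pow !min_r//; ring.
Qed.

Lemma trunc_pow_defect s gamma L r : s < gamma -> 0 < L -> 0 <= r ->
  r `^ s - trunc_pow s L r <= L `^ (s - gamma) * r `^ gamma.
Proof.
move=> sg L0 r0; rewrite /trunc_pow; have [rL|Lr] := leP r L.
  by rewrite subrr mulr_ge0// powR_ge0.
have rp : 0 < r := lt_trans L0 Lr.
apply: (@le_trans _ _ (r `^ s)); first by rewrite gerBl powR_ge0.
rewrite -[in leLHS](subrK gamma s) (@powRD _ r); last by rewrite (gt_eqF rp) implybT.
rewrite ler_wpM2r ?powR_ge0// -[s - gamma]opprB !powRN lef_pV2 ?posrE ?powR_gt0//.
by apply: ler_powR_base; [rewrite subr_ge0; exact: ltW|exact: ltW|exact: ltW].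
Qed.

(** Below L / min(a, 1 - a) the truncated power itself is comparable with r^s;
    above, the gain is L^s and the last term alone is r^gamma. *)
Lemma pow_le_trunc_gain a s gamma L r : 0 < a -> a < 1 -> 0 < s -> s <= 1 ->
  s < gamma -> 0 < L -> 0 <= r ->
  r `^ gamma <= Num.min a (1 - a) `^ (- s) * (L / Num.min a (1 - a)) `^ (gamma - s)
      * trunc_pow s L r
    + L `^ (- s) * (gain a (trunc_pow s L) r * r `^ gamma).
Proof.
move=> a0 a1 s0 s1 sg L0 r0; set m := Num.min a (1 - a).
have m0 : 0 < m by rewrite lt_min a0; lra.
have m1 : m <= 1 by rewrite ge_min ltW.
have [pT _ _] := test_profile_trunc_pow s0 s1 (ltW L0).
have G0 := gain_ge0 a0 a1 pT r0.
have [mrL|Lmr] := leP (m * r) L; last first.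
  rewrite (gain_trunc_pow _ a0 a1 (ltW L0) (ltW Lmr)).
  rewrite [_ * (_ * _)]mulrA (powRN L) mulVf ?gt_eqF ?powR_gt0// mul1r lerDr.
  by rewrite !mulr_ge0// powR_ge0.
have [r_0|rn0] := eqVneq r 0.
  rewrite r_0 in G0 *; rewrite [leLHS]powR0; last by lra.
  by rewrite addr_ge0// !mulr_ge0// powR_ge0.
have rL : r <= L / m by rewrite ler_pdivlMr// mulrC.
have T : m `^ s * r `^ s <= trunc_pow s L r.
  rewrite -powRM//; last exact: ltW.
  apply: ler_powR_base; [exact: ltW|by rewrite mulr_ge0// ltW|].
  by rewrite le_min mrL ler_piMl.
rewrite -[leLHS]addr0; apply: lerD; last by rewrite !mulr_ge0// powR_ge0.
rewrite powRN -[in leLHS](subrK s gamma) (@powRD _ r); last by rewrite rn0 implybT.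
rewrite mulrAC mulrC ler_pM ?powR_ge0//.
  by rewrite mulrC ler_pdivlMr ?powR_gt0// mulrC.
by apply: ler_powR_base => //; rewrite subr_ge0 ltW.
Qed.

(** In terms of u = min(r, U)^s and p = gamma / s this is S u - u^p, with the
    slope S = p U^(gamma - s) for which the derivative in u vanishes exactly at
    the truncation level.  The function is a profile, yet it misses S r^s by an
    amount comparable with r^gamma for r up to U: bounded profiles thereby reach
    the moment of order gamma, through a difference. *)
Definition cap_profile s gamma U r :=
  gamma / s * U `^ (gamma - s) * trunc_pow s U r - trunc_pow gamma U r.

Lemma powRB_split gamma s r : 0 <= r -> 0 < s -> s < gamma ->
  r `^ gamma = r `^ (gamma - s) * r `^ s.
Proof.
move=> r0 s0 sg; have [->|rn0] := eqVneq r 0.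
  by rewrite !powR0 ?mulr0//; lra.
by rewrite -powRD ?subrK// rn0 implybT.
Qed.

(** The tangent inequality at the s-th power of v, for the exponent gamma / s. *)
Lemma cap_base_mono s gamma U u v : 0 < s -> s < gamma -> 0 <= u -> u <= v ->
  v <= U ->
  gamma / s * U `^ (gamma - s) * u `^ s - u `^ gamma <=
  gamma / s * U `^ (gamma - s) * v `^ s - v `^ gamma.
Proof.
move=> s0 sg u0 uv vU; have v0 := le_trans u0 uv.
have p1 : 1 < gamma / s by rewrite ltr_pdivlMr// mul1r.
have e1 : s * (gamma / s) = gamma by field; lra.
have e2 : s * (gamma / s - 1) = gamma - s by field; lra.
have := powR_tangent p1 (powR_ge0 u s) (powR_ge0 v s).
rewrite -!powRrM e1 e2.
have := powRB_split v0 s0 sg => e3.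
have h1 : v `^ (gamma - s) <= U `^ (gamma - s).
  by apply: ler_powR_base => //; lra.
have h2 : u `^ s <= v `^ s by apply: ler_powR_base => //; lra.
have h3 : gamma / s * v `^ (gamma - s) * (v `^ s - u `^ s) <=
          gamma / s * U `^ (gamma - s) * (v `^ s - u `^ s).
  by rewrite ler_wpM2r ?subr_ge0// ler_wpM2l//; lra.
rewrite e3 in h3 *; move: h3.
set p := gamma / s; set A := v `^ (gamma - s); set B := U `^ _; set V := v `^ s.
set W := u `^ s; set Z := u `^ gamma.
by lra.
Qed.

Lemma cap_profile_ge s gamma U r : 0 < s -> s < gamma -> 0 <= r -> 0 <= U ->
  0 <= cap_profile s gamma U r.
Proof.
move=> s0 sg r0 U0; rewrite /cap_profile /trunc_pow.
have m0 : 0 <= Num.min r U by rewrite le_min r0.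
have mU : Num.min r U <= U by rewrite ge_min lexx orbT.
have := cap_base_mono s0 sg (lexx 0) m0 mU.
by rewrite !powR0 ?mulr0 ?subr0//; lra.
Qed.

Lemma test_profile_cap s gamma U : 0 < s -> s <= 1 -> 1 < gamma -> 0 <= U ->
  test_profile (cap_profile s gamma U).
Proof.
move=> s0 s1 g1 U0; have sg : s < gamma := le_lt_trans s1 g1.
have p0 : 0 <= gamma / s by rewrite divr_ge0//; lra.
split; [split| |].
- by move=> r r0; exact: cap_profile_ge.
- move=> r1 r2 r10 r12; apply: cap_base_mono => //.
  + by rewrite le_min r10.
  + by rewrite le_min !ge_min r12 lexx orbT.
  + by rewrite ge_min lexx orbT.
- move=> l r l0 l1 r0.
  have m0 : 0 <= Num.min r U by rewrite le_min r0.
  have lm : l * Num.min r U <= Num.min (l * r) U.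
    rewrite le_min; apply/andP; split; first by rewrite ler_wpM2l// ge_min lexx.
    apply: (@le_trans _ _ (1 * U)); last by rewrite mul1r.
    by apply: ler_pM => //; rewrite ge_min lexx orbT.
  have lmU : Num.min (l * r) U <= U by rewrite ge_min lexx orbT.
  apply: le_trans (cap_base_mono s0 sg (mulr_ge0 l0 m0) lm lmU).
  rewrite /cap_profile /trunc_pow; set m := Num.min r U.
  have [->|ln0] := eqVneq l 0.
    by rewrite !mul0r !powR0 ?mulr0 ?subr0//; lra.
  have l01 : 0 < l <= 1 by rewrite lt0r ln0 l0.
  rewrite !powRM// mulrBr; apply: lerB.
    rewrite mulrCA; apply: ler_wpM2l; first by rewrite mulr_ge0// powR_ge0.
    by apply: ler_wpM2r; [exact: powR_ge0|exact: ger1_powR].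
  by rewrite ler_wpM2r ?powR_ge0//; apply: ge1r_powR => //; exact: ltW.
- move=> x; apply: cvgB.
    by apply: cvgMr; apply: continuous_trunc_pow.
  by apply: continuous_trunc_pow => //; lra.
- exists (gamma / s * U `^ (gamma - s) * U `^ s) => r r0.
  apply: le_trans (_ : gamma / s * U `^ (gamma - s) * trunc_pow s U r <= _).
    by rewrite gerBl powR_ge0.
  by rewrite ler_wpM2l ?trunc_pow_ubound// mulr_ge0// powR_ge0.
Qed.

Lemma cap_profile_le s gamma U r : 0 < s -> s < gamma -> 0 <= U -> 0 <= r ->
  cap_profile s gamma U r <= gamma / s * U `^ (gamma - s) * r `^ s.
Proof.
move=> s0 sg U0 r0.
apply: le_trans (_ : gamma / s * U `^ (gamma - s) * trunc_pow s U r <= _).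
  by rewrite gerBl powR_ge0.
by rewrite ler_wpM2l ?trunc_pow_le// mulr_ge0// ?powR_ge0// divr_ge0//; lra.
Qed.

Lemma cap_defect_le s gamma U r : 0 < s -> s < gamma -> 0 <= U -> 0 <= r ->
  gamma / s * U `^ (gamma - s) * r `^ s - cap_profile s gamma U r
  <= gamma / s * r `^ gamma.
Proof.
move=> s0 sg U0 r0; have p1 : 1 < gamma / s by rewrite ltr_pdivlMr// mul1r.
have [rU|Ur] := leP r U.
  rewrite /cap_profile /trunc_pow min_l// opprB addrC subrK.
  by rewrite ler_peMl ?powR_ge0// ltW.
have := cap_profile_ge s0 sg r0 U0; set c := cap_profile _ _ _ _ => c0.
apply: (@le_trans _ _ (gamma / s * U `^ (gamma - s) * r `^ s)).
  by rewrite gerBl.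
rewrite (powRB_split r0 s0 sg) mulrA ler_wpM2r ?powR_ge0// ler_wpM2l//.
  by lra.
by apply: ler_powR_base => //; [lra|exact: ltW].
Qed.

(** As for the truncated powers, but now the first term is exactly r^gamma below
    the truncation level of the cap, and it is a defect of a profile instead of
    its value. *)
Lemma pow_le_cap_gain a s gamma L r : 0 < a -> a < 1 -> 0 < s -> s <= 1 ->
  s < gamma -> 0 < L -> 0 <= r ->
  r `^ gamma <=
    gamma / s * (L / Num.min a (1 - a)) `^ (gamma - s) * r `^ s
    - cap_profile s gamma (L / Num.min a (1 - a)) r
    + L `^ (- s) * (gain a (trunc_pow s L) r * r `^ gamma).
Proof.
move=> a0 a1 s0 s1 sg L0 r0; set U := L / Num.min a (1 - a).
have m0 : 0 < Num.min a (1 - a) by rewrite lt_min a0; lra.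
have U0 : 0 <= U by rewrite divr_ge0// ltW.
have [pT _ _] := test_profile_trunc_pow s0 s1 (ltW L0).
have G0 := gain_ge0 a0 a1 pT r0.
have [rU|Ur] := leP r U.
  have -> : cap_profile s gamma U r =
      gamma / s * U `^ (gamma - s) * r `^ s - r `^ gamma.
    by rewrite /cap_profile /trunc_pow !min_l.
  by rewrite subKr lerDl !mulr_ge0// powR_ge0.
rewrite (gain_trunc_pow _ a0 a1 (ltW L0)); last first.
  by move: Ur => /ltW; rewrite /U ler_pdivrMr// mulrC.
rewrite [_ * (_ * _)]mulrA (powRN L) mulVf ?gt_eqF ?powR_gt0// mul1r lerDr.
by rewrite subr_ge0 cap_profile_le.
Qed.

Lemma gainD a g h r : gain a (g \+ h) r = gain a g r + gain a h r.
Proof. by rewrite /gain /=; ring. Qed.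

Lemma gainZ a c g r : gain a (fun x => c * g x) r = c * gain a g r.
Proof. by rewrite /gain /=; ring. Qed.

End TruncatedPowers.

(** * The collision operator on test profiles *)

Section ProductIntegrals.
Context d1 d2 (T1 : measurableType d1) (T2 : measurableType d2) (R : realType).
Variables (m1 : {sigma_finite_measure set T1 -> \bar R})
          (m2 : {sigma_finite_measure set T2 -> \bar R}).
Implicit Types (u : T1 -> R) (v : T2 -> R).

Lemma integrable_prod_fun u v : m1.-integrable setT (EFin \o u) ->
  m2.-integrable setT (EFin \o v) ->
  (m1 \x m2)%E.-integrable setT (EFin \o (fun z => u z.1 * v z.2)).
Proof.
move=> iu iv; have mu := measurable_int m1 iu; have mv := measurable_int m2 iv.
have mu' : measurable_fun setT u by exact/measurable_EFinP.
have mv' : measurable_fun setT v by exact/measurable_EFinP.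
have muv : measurable_fun setT (EFin \o (fun z : T1 * T2 => u z.1 * v z.2)).
  apply/measurable_EFinP; apply: measurable_funM.
    by apply: (measurableT_comp mu'); exact: measurable_fst.
  by apply: (measurableT_comp mv'); exact: measurable_snd.
apply/integrable12ltyP => //=.
have nv : (\int[m2]_y `|(v y)%:E|)%E \is a fin_num.
  have /integrableP[_ h] := iv.
  by rewrite ge0_fin_numE ?integral_ge0.
have -> : (\int[m1]_x \int[m2]_y `|(u x * v y)%:E|)%E =
    (\int[m1]_x (`|(u x)%:E| * \int[m2]_y `|(v y)%:E|))%E.
  apply: eq_integral => x _.
  rewrite -ge0_integralZl//; last by apply: measurableT_comp.
  by apply: eq_integral => y _; rewrite EFinM abseM.
rewrite ge0_integralZr//.
- have nu : (\int[m1]_x `|(u x)%:E|)%E \is a fin_num.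
    have /integrableP[_ h] := iu.
    by rewrite ge0_fin_numE ?integral_ge0.
  by rewrite -(fineK nu) -(fineK nv) -EFinM ltry.
- by apply: measurableT_comp.
- exact: integral_ge0.
Qed.

Lemma Rintegral_prod_fun u v : m1.-integrable setT (EFin \o u) ->
  m2.-integrable setT (EFin \o v) ->
  \int[(m1 \x m2)%E]_z (u z.1 * v z.2) = \int[m1]_x u x * \int[m2]_y v y.
Proof.
move=> iu iv; have iuv := integrable_prod_fun iu iv.
have nv := integrable_fin_num measurableT iv.
have nu := integrable_fin_num measurableT iu.
set U := \int[m1]_x u x; set V := \int[m2]_y v y.
have eU : (\int[m1]_x (EFin \o u) x = U%:E)%E by rewrite /U /Rintegral fineK.
have eV : (\int[m2]_x (EFin \o v) x = V%:E)%E by rewrite /V /Rintegral fineK.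
suff e : (\int[m1 \x m2]_z (u z.1 * v z.2)%:E)%E = (U * V)%:E.
  by rewrite [LHS]/Rintegral e.
have <- := integral12_prod_meas1 iuv.
transitivity (\int[m1]_x ((u x)%:E * V%:E))%E.
  apply: eq_integral => x _.
  transitivity (\int[m2]_y ((u x)%:E * (v y)%:E))%E; first exact: eq_integral.
  by rewrite (integralZl measurableT iv) eV.
by rewrite (integralZr measurableT iu) EFinM eU.
Qed.

End ProductIntegrals.

Section MomentIntegrals.
Context {R : realType} (mu : borel_measure R).
Implicit Types (f g : R -> R) (a p q gamma x y : R).

Lemma integrable_le (f g : R -> R) : measurable_fun setT f ->
  (forall x, `|f x| <= g x) -> mu.-integrable setT (EFin \o g) ->
  mu.-integrable setT (EFin \o f).
Proof.
move=> mf fg ig; apply: le_integrable ig => //; first exact/measurable_EFinP.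
move=> x _ /=; rewrite lee_fin; apply: le_trans (fg x) _.
exact: ler_norm.
Qed.

Lemma measurable_powR_norm p : 0 < p ->
  measurable_fun setT (fun x : R => `|x| `^ p).
Proof.
move=> p0; apply: continuous_measurable_fun; exact: continuous_powR_norm.
Qed.

Lemma integrable_powR_norm p q : 0 < p -> p <= q -> in_Mplus q mu ->
  mu.-integrable setT (EFin \o (fun x : R => `|x| `^ p)).
Proof.
move=> p0 pq muq.
have b1 x : 1 <= 1 + x ^+ 2 by rewrite lerDl sqr_ge0.
have mW : measurable_fun setT (fun x : R => (1 + x ^+ 2) `^ (q / 2)).
  apply: (measurableT_comp (measurable_powR _)).
  apply: measurable_funD; first exact: measurable_cst.
  by apply: continuous_measurable_fun; exact: exprn_continuous.
apply: (@integrable_le _ (fun x => (1 + x ^+ 2) `^ (q / 2))).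
- exact: measurable_powR_norm.
- move=> x; rewrite ger0_norm ?powR_ge0//.
  apply: (@le_trans _ _ ((1 + x ^+ 2) `^ (p / 2))); last first.
    by apply: ler_powR => //; rewrite ler_pM2r.
  have -> : `|x| `^ p = (x ^+ 2) `^ (p / 2).
    rewrite -(real_normK (num_real x)) -powR_mulrn// -powRrM; congr (_ `^ _).
    by field.
  by apply: ler_powR_base; rewrite ?sqr_ge0 ?lerDr// divr_ge0// ltW.
- apply/integrableP; split; first exact/measurable_EFinP.
  move: muq; rewrite /in_Mplus /weighted_norm; apply: le_lt_trans.
  rewrite le_eqVlt; apply/orP; left; apply/eqP; apply: eq_integral => x _ /=.
  by rewrite ger0_norm// powR_ge0.
Qed.

Lemma measurable_test_profile g : test_profile g ->
  measurable_fun setT (fun x : R => g `|x|).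
Proof. by move=> [_ cg _]; exact: continuous_measurable_fun. Qed.

Lemma integrable_test_profile g : test_profile g ->
  mu.-integrable setT (EFin \o (fun x : R => g `|x|)).
Proof.
move=> tg; have [[g0 _ _] cg [M gM]] := tg.
apply: (@integrable_le _ (fun=> M)).
- exact: measurable_test_profile.
- by move=> x; rewrite ger0_norm ?g0// gM.
- exact: finite_measure_integrable_cst.
Qed.

Lemma continuous_gain a g : 0 < a -> a < 1 -> test_profile g ->
  continuous (fun x : R => gain a g `|x|).
Proof.
move=> a0 a1 [_ cg _].
have cZ l : 0 <= l -> continuous (fun x : R => g (l * `|x|)).
  move=> l0 x.
  have -> : (fun x : R => g (l * `|x|)) = (fun y : R => g `|y|) \o ( *%R l).
    by apply/funext => y /=; rewrite normrM (ger0_norm l0).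
  apply: continuous_comp; last exact: cg.
  exact: mulrl_continuous.
move=> x; apply: cvgB; last exact: cg.
by apply: cvgD; apply: cZ; lra.
Qed.

Lemma integrable_gain_pow a gamma g : 0 < a -> a < 1 -> 0 < gamma ->
  test_profile g -> mu.-integrable setT (EFin \o (fun x : R => `|x| `^ gamma)) ->
  mu.-integrable setT (EFin \o (fun x : R => gain a g `|x| * `|x| `^ gamma)).
Proof.
move=> a0 a1 ga0 tg im; have [pg _ [M gM]] := tg.
apply: (@integrable_le _ (fun x => M * `|x| `^ gamma)).
- apply: measurable_funM; last exact: measurable_powR_norm.
  by apply: continuous_measurable_fun; exact: continuous_gain.
- move=> x; rewrite ger0_norm ?mulr_ge0 ?powR_ge0 ?gain_ge0//.
  rewrite ler_wpM2r ?powR_ge0// (le_trans (gain_le a0 a1 pg _))//.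
  exact: gM.
- exact: (integrableZl measurableT M im).
Qed.

End MomentIntegrals.

Section CollisionLowerBound.
Context {R : realType} (mu : borel_measure R).
Implicit Types (f g : R -> R) (a p q gamma x y : R).

Lemma powR_normB_le gamma x y : 0 <= gamma ->
  `|x - y| `^ gamma <= 2 `^ gamma * (`|x| `^ gamma + `|y| `^ gamma).
Proof.
move=> ga0; wlog yx : x y / `|y| <= `|x|.
  move=> H; have [yx|/ltW xy] := leP `|y| `|x|; first exact: H.
  by rewrite distrC [_ + `|y| `^ _]addrC; exact: H.
apply: (@le_trans _ _ ((2 * `|x|) `^ gamma)).
  by apply: ler_powR_base => //; have := ler_normB x y; lra.
by rewrite powRM// ler_wpM2l ?powR_ge0// lerDl powR_ge0.
Qed.

(** The pointwise estimate is integrated over pairs: the gain terms depend on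
    one particle only and keep their value because the mass is 1, the loss
    terms factorize.  As g is bounded, a finite moment of order gamma makes
    everything integrable. *)
Lemma collision_lb a gamma g : 0 < a -> a < 1 -> 0 < gamma ->
  mu setT = 1%E ->
  mu.-integrable setT (EFin \o (fun x : R => `|x| `^ gamma)) ->
  test_profile g ->
  2 `^ (- gamma) * \int[mu]_x (gain a g `|x| * `|x| `^ gamma)
    - 6 * 2 `^ gamma * (\int[mu]_x (`|x| `^ gamma) * \int[mu]_x g `|x|)
  <= collision a gamma mu mu (fun x => g `|x|).
Proof.
move=> a0 a1 ga0 mu1 im tg; have [pg cg [M gM]] := tg.
have [g0 _ _] := pg.
have ig := integrable_test_profile mu tg.
have ip := integrable_gain_pow a0 a1 ga0 tg im.
have i1 : mu.-integrable setT (EFin \o (fun _ : R => 1 : R)).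
  exact: finite_measure_integrable_cst.
have r1 : \int[mu]_x (1 : R) = 1.
  by rewrite Rintegral_cst// mul1r; exact: (congr1 fine mu1).
set u := fun x : R => gain a g `|x| * `|x| `^ gamma.
set w := fun x : R => `|x| `^ gamma.
set h := fun x : R => g `|x|.
have iu1 := integrable_prod_fun ip i1.
have i1u := integrable_prod_fun i1 ip.
have iwh := integrable_prod_fun im ig.
have ihw := integrable_prod_fun ig im.
have iw1 := integrable_prod_fun im i1.
have i1w := integrable_prod_fun i1 im.
set c := 2 `^ (- gamma); set C := 6 * 2 `^ gamma.
pose F (z : R * R) := `|z.1 - z.2| `^ gamma * collision_increment a h z.1 z.2.
have mh : measurable_fun setT h by exact: measurable_test_profile.
have iF : (mu \x mu)%E.-integrable setT (EFin \o F).
  have iJ := integrableZl measurableT (2 `^ gamma * (2 * M))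
    (integrableD measurableT iw1 i1w).
  apply: (le_integrable measurableT _ _ iJ).
  - apply/measurable_EFinP; apply: measurable_funM.
      apply: (measurableT_comp (measurable_powR_norm ga0)).
      by apply: measurable_funB; [exact: measurable_fst|exact: measurable_snd].
    have mA l k : measurable_fun setT (fun z : R * R => h (l * z.1 + k * z.2)).
      apply: (measurableT_comp mh); apply: measurable_funD.
        by apply: measurable_funM => //; exact: measurable_fst.
      by apply: measurable_funM => //; exact: measurable_snd.
    apply: measurable_funB.
      apply: measurable_funB; last by apply: (measurableT_comp mh); exact: measurable_fst.
      by apply: measurable_funD; exact: mA.
    by apply: (measurableT_comp mh); exact: measurable_snd.
  - move=> z _; rewrite /= lee_fin /F normrM ger0_norm ?powR_ge0//.
    apply: le_trans (ler_norm _); rewrite mulr1 mul1r mulrAC.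
    apply: ler_pM; rewrite ?powR_ge0 ?normr_ge0//.
      exact: powR_normB_le (ltW ga0).
    have b x : 0 <= h x <= M by rewrite g0// gM.
    rewrite /collision_increment ler_norml.
    have := b (a * z.1 + (1 - a) * z.2); have := b ((1 - a) * z.1 + a * z.2).
    by have := b z.1; have := b z.2; lra.
pose L (z : R * R) :=
  c * (u z.1 * 1 + 1 * u z.2) - C * (w z.1 * h z.2 + h z.1 * w z.2).
have iD1 := integrableD measurableT iu1 i1u.
have iD2 := integrableD measurableT iwh ihw.
have iL : (mu \x mu)%E.-integrable setT (EFin \o L).
  exact: (integrableB measurableT (integrableZl measurableT c iD1)
    (integrableZl measurableT C iD2)).
have LF : \int[(mu \x mu)%E]_z L z <= \int[(mu \x mu)%E]_z F z.
  apply: le_Rintegral => // z _.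
  rewrite /L /F /u /w /h mulr1 mul1r.
  exact: weighted_increment_lb.
have -> : collision a gamma mu mu (fun x => g `|x|) =
    2^-1 * \int[(mu \x mu)%E]_z F z.
  by [].
have eL : \int[(mu \x mu)%E]_z L z =
    c * (\int[mu]_x u x + \int[mu]_x u x) -
    C * (\int[mu]_x w x * \int[mu]_x h x + \int[mu]_x h x * \int[mu]_x w x).
  rewrite /L RintegralB//; last 2 first.
    exact: (integrableZl measurableT c iD1).
    exact: (integrableZl measurableT C iD2).
  rewrite RintegralZl// RintegralZl// RintegralD// RintegralD//.
  have -> : \int[(mu \x mu)%E]_z (u z.1 * 1) = \int[mu]_x u x.
    rewrite (Rintegral_prod_fun ip i1) -[RHS]mulr1; congr (_ * _); exact: r1.
  have -> : \int[(mu \x mu)%E]_z (1 * u z.2) = \int[mu]_x u x.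
    rewrite (Rintegral_prod_fun i1 ip) -[RHS]mul1r; congr (_ * _); exact: r1.
  by rewrite (Rintegral_prod_fun im ig) (Rintegral_prod_fun ig im).
rewrite eL in LF.
set U := \int[mu]_x u x in LF *; set W := \int[mu]_x w x in LF *.
set H := \int[mu]_x h x in LF *.
by lra.
Qed.
End CollisionLowerBound.

(** * Evolution of averages in time *)

Section Barrier.
Context {R : realType}.

Lemma within_continuous_eps_delta (f : R -> R) (A : set R) (x e : R) :
  {within A, continuous f} -> A x -> 0 < e ->
  exists2 d, 0 < d & forall y, A y -> `|y - x| < d -> `|f y - f x| < e.
Proof.
move=> /subspace_continuousP cf Ax e0; have /cvgrPdist_lt /(_ _ e0) := cf x Ax.
rewrite near_withinE => /nbhs_ballP[d /= d0 h]; exists d => // y Ay yx.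
rewrite distrC; apply: h => //.
by rewrite /ball /= distrC.
Qed.

(** Only what happens after the last time at which f reaches m matters: from
    there on f stays below m, so that the growth condition applies.  *)
Lemma barrier (f : R -> R) (t1 t2 m K : R) : t1 <= t2 -> 0 <= K ->
  {within `[t1, t2], continuous f} -> m <= f t1 ->
  (forall u v, t1 <= u -> u <= v -> v <= t2 ->
     (forall x, u <= x -> x <= v -> f x <= m) -> f u - K * (v - u) <= f v) ->
  m - K * (t2 - t1) <= f t2.
Proof.
move=> t12 K0 cf mf1 step.
(* The last such time is the supremum of A; as f there is known only by
   continuity, the growth condition is used from a slightly later time u on. *)
pose A := [set x | [/\ t1 <= x, x <= t2 & m <= f x]].
have At1 : A t1 by split.
have supA : has_sup A by split; [exists t1|exists t2 => x []].
have s1 : t1 <= sup A by apply: ub_le_sup => //; exact: supA.2.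
have s2 : sup A <= t2 by apply: ge_sup; [exists t1|move=> x []].
apply/ler_addgt0Pl => e e0.
have e20 : 0 < e / 2 by rewrite divr_gt0.
have Is : `[t1, t2]%classic (sup A) by rewrite /= in_itv/= s1 s2.
have [d d0 Hd] := within_continuous_eps_delta cf Is e20.
have [x [x1 x2 mx] sx] := sup_adherent d0 supA.
have xs : x <= sup A by apply: ub_le_sup; [exact: supA.2|split].
have fs : m - e / 2 < f (sup A).
  have h : `|f x - f (sup A)| < e / 2.
    by apply: Hd; rewrite /= ?in_itv/= ?x1// ler0_norm ?subr_le0//; lra.
  by move: h; rewrite ltr_norml => /andP[_]; lra.
have Kt0 : 0 <= K * (t2 - t1) by rewrite mulr_ge0// subr_ge0.
have [s2e|s2n] := eqVneq (sup A) t2.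
  by rewrite s2e in fs; lra.
have s2' : sup A < t2 by rewrite lt_neqAle s2n.
pose u := Num.min (sup A + d / 2) t2.
have us : sup A < u by rewrite lt_min s2' andbT; lra.
have u2 : u <= t2 by rewrite ge_min lexx orbT.
have ud : u <= sup A + d / 2 by rewrite ge_min lexx.
have t1u : t1 <= u by exact: le_trans s1 (ltW us).
have fu : f (sup A) - e / 2 < f u.
  have h : `|f u - f (sup A)| < e / 2.
    by apply: Hd; rewrite /= ?in_itv/= ?t1u// gtr0_norm ?subr_gt0//; lra.
  by move: h; rewrite ltr_norml => /andP[]; lra.
have fum : f u - K * (t2 - u) <= f t2.
  apply: step => // y uy y2; rewrite leNgt; apply/negP => my.
  have : y <= sup A.
    apply: ub_le_sup; first exact: supA.2.
    by split; [exact: le_trans uy|exact: y2|exact: ltW].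
  by rewrite leNgt (lt_le_trans us uy).
have : K * (t2 - u) <= K * (t2 - t1) by rewrite ler_wpM2l// lerB.
by lra.
Qed.

End Barrier.

Section WeakSolutionInTime.
Context {R : realType} (a gamma : R) (mu0 : borel_measure R)
        (mu : R -> borel_measure R).
Implicit Types (t s : R) (phi g : R -> R).

Definition bounded_continuous phi :=
  continuous phi /\ [bounded phi x | x in setT].

Lemma bounded_continuous_test_profile g : test_profile g ->
  bounded_continuous (fun x => g `|x|).
Proof.
move=> [[g0 _ _] cg [M gM]]; split => //.
exists M; split; first exact: num_real.
by move=> N MN x _ /=; rewrite ger0_norm ?g0// (le_trans (gM _ _))// ltW.
Qed.

Lemma weak_identity phi t : measure_weak_solution a gamma mu0 mu ->
  bounded_continuous phi -> 0 <= t ->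
  \int[mu t]_x phi x = \int[mu0]_x phi x +
    \int[@lebesgue_measure R]_(tau in `[0, t])
       collision a gamma (mu tau) (mu tau) phi.
Proof. by move=> [_ _ _ sol] [cp bp]; have [_ _] := sol phi cp bp; apply. Qed.

Lemma collision_integrable phi t : measure_weak_solution a gamma mu0 mu ->
  bounded_continuous phi ->
  (@lebesgue_measure R).-integrable `[0, t]
    (EFin \o (fun tau => collision a gamma (mu tau) (mu tau) phi)).
Proof.
move=> [_ _ _ sol] [cp bp]; have [_ L _] := sol phi cp bp.
apply: L; last exact: segment_compact.
by move=> x /=; rewrite !in_itv/= andbT => /andP[].
Qed.

Lemma mean_at0 phi : measure_weak_solution a gamma mu0 mu ->
  bounded_continuous phi -> \int[mu 0]_x phi x = \int[mu0]_x phi x.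
Proof.
move=> sol bp; rewrite (weak_identity sol bp (lexx 0)).
by rewrite set_itv1 Rintegral_set1 addr0.
Qed.

Lemma mean_continuous phi t : measure_weak_solution a gamma mu0 mu ->
  bounded_continuous phi -> 0 <= t ->
  {within `[0, t], continuous (fun tau => \int[mu tau]_x phi x)}.
Proof.
move=> sol bp t0.
have c := parameterized_integral_continuous t0 (collision_integrable t sol bp).
apply: (@subspace_eq_continuous _ _ _ (fun tau => \int[mu0]_x phi x +
    parameterized_integral (@lebesgue_measure R) 0 tau
      (fun tau => collision a gamma (mu tau) (mu tau) phi))).
  move=> x; rewrite inE/= in_itv/= => /andP[x0 _].
  exact: esym (weak_identity sol bp x0).
by move=> x; apply: cvgD; [exact: cvg_cst|exact: c].
Qed.

Lemma mean_increment_ge phi K t1 t2 : measure_weak_solution a gamma mu0 mu ->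
  bounded_continuous phi -> 0 <= t1 -> t1 <= t2 ->
  (forall tau, t1 <= tau -> tau <= t2 ->
     - K <= collision a gamma (mu tau) (mu tau) phi) ->
  \int[mu t1]_x phi x - K * (t2 - t1) <= \int[mu t2]_x phi x.
Proof.
move=> sol bp t10 t12 KQ; have t20 := le_trans t10 t12.
rewrite (weak_identity sol bp t10) (weak_identity sol bp t20) -addrA lerD2l.
have iQ := collision_integrable t2 sol bp.
have := @Rintegral_itvB R _ (BLeft 0) (BRight t2) t1 iQ.
rewrite !bnd_simp => /(_ t10 t12) e.
have iQ2 : (@lebesgue_measure R).-integrable `]t1, t2]
    (EFin \o (fun tau => collision a gamma (mu tau) (mu tau) phi)).
  apply: integrableS iQ => // x /=; rewrite !in_itv/= => /andP[t1x ->].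
  by rewrite (ltW (le_lt_trans t10 t1x)).
have iK : (@lebesgue_measure R).-integrable `[t1, t2] (EFin \o (fun=> - K)).
  apply: continuous_compact_integrable; first exact: segment_compact.
  by move=> x; exact: cvg_cst.
have sub : `]t1, t2] `<=` `[t1, t2].
  by move=> x /=; rewrite !in_itv/= => /andP[/ltW -> ->].
have : \int[@lebesgue_measure R]_(tau in `]t1, t2]) (- K) <=
    \int[@lebesgue_measure R]_(tau in `]t1, t2])
      collision a gamma (mu tau) (mu tau) phi.
  apply: le_Rintegral => //.
    exact: integrableS iK.
  move=> x /=; rewrite in_itv/= => /andP[t1x xt2].
  by apply: KQ => //; exact: ltW.
rewrite Rintegral_cst//= lebesgue_measure_itv/= lte_fin.
have [lt12|le21] := ltP t1 t2; rewrite /= -e ?mulr0; first by lra.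
by have -> : t2 - t1 = 0; lra.
Qed.

End WeakSolutionInTime.

(** * Moments and averages of profiles *)

Section MeansOfProfiles.
Context {R : realType} (a s gamma : R).
Implicit Types (mu nu : borel_measure R) (g h : R -> R) (A L k l r sigma : R).

Definition rmoment p mu : R := \int[mu]_x (`|x| `^ p).
Definition pmean g mu : R := \int[mu]_x g `|x|.
Definition gain_moment g mu : R := \int[mu]_x (gain a g `|x| * `|x| `^ gamma).

Definition finite_moments mu :=
  [/\ mu setT = 1%E,
      mu.-integrable setT (EFin \o (fun x : R => `|x| `^ s)) &
      mu.-integrable setT (EFin \o (fun x : R => `|x| `^ gamma))].

Lemma pmeanD mu g h : test_profile g -> test_profile h ->
  pmean (g \+ h) mu = pmean g mu + pmean h mu.
Proof.
move=> tg th; rewrite /pmean RintegralD//; exact: integrable_test_profile.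
Qed.

Lemma pmeanZ mu c g : test_profile g ->
  pmean (fun r => c * g r) mu = c * pmean g mu.
Proof.
by move=> tg; rewrite /pmean RintegralZl//; exact: integrable_test_profile.
Qed.

Lemma pmean_ge0 mu g : test_profile g -> 0 <= pmean g mu.
Proof. by move=> [[g0 _ _] _ _]; apply: Rintegral_ge0 => x _; exact: g0. Qed.

Lemma gain_momentD mu g h : 0 < a -> a < 1 -> 0 < gamma -> finite_moments mu ->
  test_profile g -> test_profile h ->
  gain_moment (g \+ h) mu = gain_moment g mu + gain_moment h mu.
Proof.
move=> a0 a1 ga0 [_ _ im] tg th; rewrite /gain_moment.
under eq_Rintegral do rewrite gainD mulrDl.
by rewrite RintegralD//; exact: integrable_gain_pow.
Qed.

Lemma gain_momentZ mu c g : 0 < a -> a < 1 -> 0 < gamma -> finite_moments mu ->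
  test_profile g -> gain_moment (fun r => c * g r) mu = c * gain_moment g mu.
Proof.
move=> a0 a1 ga0 [_ _ im] tg; rewrite /gain_moment.
under eq_Rintegral do rewrite gainZ -mulrA.
by rewrite RintegralZl//; exact: integrable_gain_pow.
Qed.

Lemma gain_moment_ge0 mu g : 0 < a -> a < 1 -> test_profile g ->
  0 <= gain_moment g mu.
Proof.
move=> a0 a1 [pg _ _]; apply: Rintegral_ge0 => x _.
by rewrite mulr_ge0 ?powR_ge0 ?gain_ge0.
Qed.

Lemma rmoment_ge0 mu p : 0 <= rmoment p mu.
Proof. by apply: Rintegral_ge0 => x _; exact: powR_ge0. Qed.

Lemma pmean_le_rmoment mu g sigma : finite_moments mu -> test_profile g ->
  (forall r, 0 <= r -> g r <= sigma * r `^ s) ->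
  pmean g mu <= sigma * rmoment s mu.
Proof.
move=> [_ is_ _] tg gs; rewrite /rmoment -RintegralZl//.
apply: le_Rintegral => //; first exact: integrable_test_profile.
  exact: (integrableZl measurableT sigma is_).
by move=> x _; exact: gs.
Qed.

Lemma trunc_mean_defect mu L : 0 < s -> s <= 1 -> s < gamma -> 0 < L ->
  finite_moments mu ->
  rmoment s mu - pmean (trunc_pow s L) mu <= L `^ (s - gamma) * rmoment gamma mu.
Proof.
move=> s0 s1 sg L0 [_ is_ im].
have tT := test_profile_trunc_pow s0 s1 (ltW L0).
have iT := integrable_test_profile mu tT.
rewrite /rmoment /pmean -RintegralB// -RintegralZl//.
apply: le_Rintegral => //.
- exact: (integrableB measurableT is_ iT).
- exact: (integrableZl measurableT _ im).
- by move=> x _; exact: trunc_pow_defect.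
Qed.

Lemma trunc_mean_approx mu e : 0 < s -> s <= 1 -> s < gamma ->
  finite_moments mu -> 0 < e ->
  exists2 L, 0 < L & rmoment s mu - e <= pmean (trunc_pow s L) mu.
Proof.
move=> s0 s1 sg fm e0.
have M0 := rmoment_ge0 mu gamma.
have d0 : 0 < e / (rmoment gamma mu + 1) by rewrite divr_gt0//; lra.
have sg0 : s - gamma != 0 by rewrite subr_eq0 lt_eqF.
exists ((e / (rmoment gamma mu + 1)) `^ (s - gamma)^-1); first exact: powR_gt0.
have := trunc_mean_defect s0 s1 sg (powR_gt0 (s - gamma)^-1 d0) fm.
rewrite -powRrM (mulVf sg0) (powRr1 (ltW d0)).
rewrite mulrAC -mulrA; set X := rmoment gamma mu / _.
have X1 : X <= 1 by rewrite /X ler_pdivrMr ?mul1r; lra.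
have : e * X <= e by rewrite ler_piMr// ltW.
by lra.
Qed.

Lemma rmoment_le_trunc_gain mu L : 0 < a -> a < 1 -> 0 < s -> s <= 1 ->
  s < gamma -> 0 < L -> finite_moments mu ->
  rmoment gamma mu <=
    Num.min a (1 - a) `^ (- s) * (L / Num.min a (1 - a)) `^ (gamma - s)
      * pmean (trunc_pow s L) mu
    + L `^ (- s) * gain_moment (trunc_pow s L) mu.
Proof.
move=> a0 a1 s0 s1 sg L0 [_ is_ im]; have ga0 : 0 < gamma by lra.
have tT := test_profile_trunc_pow s0 s1 (ltW L0).
have iT := integrable_test_profile mu tT.
have iG := integrable_gain_pow a0 a1 ga0 tT im.
rewrite /rmoment /pmean /gain_moment -RintegralZl// -RintegralZl// -RintegralD//.
- apply: le_Rintegral => //.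
  + exact: (integrableD measurableT (integrableZl measurableT _ iT)
      (integrableZl measurableT _ iG)).
  + by move=> x _; exact: pow_le_trunc_gain.
- exact: (integrableZl measurableT _ iT).
- exact: (integrableZl measurableT _ iG).
Qed.

(** Average of the amount missing in cap_profile: it lies between the moment of
    order gamma of the sizes up to U and gamma / s times the full one. *)
Definition cap_defect U mu : R :=
  gamma / s * U `^ (gamma - s) * rmoment s mu - pmean (cap_profile s gamma U) mu.

Lemma rmoment_le_cap_gain mu L : 0 < a -> a < 1 -> 0 < s -> s <= 1 ->
  1 < gamma -> 0 < L -> finite_moments mu ->
  rmoment gamma mu <= cap_defect (L / Num.min a (1 - a)) mu
    + L `^ (- s) * gain_moment (trunc_pow s L) mu.
Proof.
move=> a0 a1 s0 s1 g1 L0 [_ is_ im]; have ga0 : 0 < gamma by lra.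
have sg : s < gamma by lra.
have m0 : 0 < Num.min a (1 - a) by rewrite lt_min a0; lra.
have U0 : 0 <= L / Num.min a (1 - a) by rewrite divr_ge0// ltW.
have tT := test_profile_trunc_pow s0 s1 (ltW L0).
have iT := integrable_test_profile mu (test_profile_cap s0 s1 g1 U0).
have iG := integrable_gain_pow a0 a1 ga0 tT im.
rewrite /cap_defect /rmoment /pmean /gain_moment -RintegralZl// -RintegralZl//.
have iS := integrableZl measurableT
  (gamma / s * (L / Num.min a (1 - a)) `^ (gamma - s)) is_.
rewrite -RintegralB// -RintegralD//.
- apply: le_Rintegral => //.
  + exact: (integrableD measurableT (integrableB measurableT iS iT)
      (integrableZl measurableT _ iG)).
  + by move=> x _; exact: pow_le_cap_gain.
- exact: (integrableB measurableT iS iT).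
- exact: (integrableZl measurableT _ iG).
Qed.

Lemma cap_defect_ub mu U : 0 < s -> s <= 1 -> 1 < gamma -> 0 <= U ->
  finite_moments mu -> cap_defect U mu <= gamma / s * rmoment gamma mu.
Proof.
move=> s0 s1 g1 U0 [_ is_ im]; have sg : s < gamma by lra.
have iT := integrable_test_profile mu (test_profile_cap s0 s1 g1 U0).
rewrite /cap_defect /rmoment /pmean -RintegralZl// -RintegralZl//.
have iS := integrableZl measurableT (gamma / s * U `^ (gamma - s)) is_.
rewrite -RintegralB//; apply: le_Rintegral => //.
- exact: (integrableB measurableT iS iT).
- exact: (integrableZl measurableT _ im).
- by move=> x _; exact: cap_defect_le.
Qed.

(** Inserting the bound on the moment of order gamma into collision_lb, the
    smallness condition lets the production absorb the loss that is
    proportional to it. *)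
Lemma collision_ge_controlled mu g E d : 0 < a -> a < 1 -> 0 < gamma ->
  finite_moments mu -> test_profile g ->
  rmoment gamma mu <= E + d * gain_moment g mu ->
  6 * 2 `^ gamma * pmean g mu * d <= 2 `^ (- gamma) ->
  - (6 * 2 `^ gamma * E * pmean g mu) <= collision a gamma mu mu (fun x => g `|x|).
Proof.
move=> a0 a1 ga0 [mu1 _ im] tg ME Id.
have := collision_lb a0 a1 ga0 mu1 im tg.
rewrite -/(gain_moment g mu) -/(rmoment gamma mu) -/(pmean g mu).
have G0 := gain_moment_ge0 mu a0 a1 tg; have I0 := pmean_ge0 mu tg.
have C0 : 0 <= 6 * 2 `^ gamma :> R by rewrite mulr_ge0// powR_ge0.
move: ME Id G0 I0 C0; set M := rmoment gamma mu; set G := gain_moment g mu.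
set I := pmean g mu; set C := 6 * 2 `^ gamma; set c := 2 `^ (- gamma).
move=> ME Id G0 I0 C0.
have h1 : C * I * M <= C * I * (E + d * G) by rewrite ler_wpM2l// mulr_ge0.
have h2 : C * I * d * G <= c * G by rewrite ler_wpM2r.
by lra.
Qed.

(** Split at |x| = l: the first term dominates below, the second one above. *)
Lemma rmoment_interp nu l : 0 < s -> s < gamma -> 0 < l ->
  finite_moments nu ->
  nu.-integrable setT (EFin \o (fun x : R => `|x| `^ (s + gamma))) ->
  rmoment gamma nu <=
    l `^ (gamma - s) * rmoment s nu + l `^ (- s) * rmoment (s + gamma) nu.
Proof.
move=> s0 sg l0 [_ is_ im] ik; rewrite /rmoment -RintegralZl// -RintegralZl//.
have i1 := integrableZl measurableT (l `^ (gamma - s)) is_.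
have i2 := integrableZl measurableT (l `^ (- s)) ik.
rewrite -RintegralD//; apply: le_Rintegral => //.
  exact: (integrableD measurableT i1 i2).
move=> x _; have x0 := normr_ge0 x; have xs0 := powR_ge0 `|x| s.
have xg0 := powR_ge0 `|x| gamma.
have [xl|lx] := leP `|x| l.
  apply: (@le_trans _ _ (l `^ (gamma - s) * `|x| `^ s)).
    rewrite (powRB_split x0 s0 sg) ler_wpM2r//.
    by apply: ler_powR_base => //; lra.
  by rewrite lerDl mulr_ge0// powR_ge0.
have xp : 0 < `|x| := lt_trans l0 lx.
apply: (@le_trans _ _ (l `^ (- s) * `|x| `^ (s + gamma))); last first.
  by rewrite lerDr mulr_ge0// powR_ge0.
rewrite [`|x| `^ (s + gamma)]powRD; last by rewrite (gt_eqF xp) implybT.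
rewrite mulrA ler_peMl// powRN mulrC ler_pdivlMr ?powR_gt0// mul1r.
by apply: ler_powR_base; exact: ltW.
Qed.

(** The choice l = A^(1 / gamma) f^(1 / s) makes the two terms of the
    interpolation equal. *)
Lemma moment_interp_bound nu A : 0 < s -> s < gamma -> 1 <= A ->
  0 < rmoment s nu -> finite_moments nu ->
  nu.-integrable setT (EFin \o (fun x : R => `|x| `^ (s + gamma))) ->
  rmoment (s + gamma) nu <= A * rmoment s nu `^ (1 + gamma / s) ->
  rmoment gamma nu <= 2 * (A `^ (1 - s / gamma) * rmoment s nu `^ (gamma / s)).
Proof.
move=> s0 sg A1 f00 fm ik; set f0 := rmoment s nu in f00 * => mA.
have A0 : 0 < A by lra.
have ga0 : 0 < gamma by lra.
pose l := A `^ gamma^-1 * f0 `^ s^-1.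
have l0 : 0 < l by rewrite mulr_gt0 ?powR_gt0.
have := rmoment_interp s0 sg l0 fm ik; rewrite -/f0.
have lx x : l `^ x = A `^ (gamma^-1 * x) * f0 `^ (s^-1 * x).
  by rewrite powRM ?powR_ge0// -!powRrM.
have fD x y : f0 `^ (x + y) = f0 `^ x * f0 `^ y.
  by rewrite powRD// (gt_eqF f00) implybT.
have h1 : l `^ (gamma - s) * f0 = A `^ (1 - s / gamma) * f0 `^ (gamma / s).
  rewrite lx -mulrA -[in X in _ * (_ * X)](powRr1 (ltW f00)) -fD.
  by congr (A `^ _ * f0 `^ _); field; lra.
have h2 : l `^ (- s) * (A * f0 `^ (1 + gamma / s)) =
    A `^ (1 - s / gamma) * f0 `^ (gamma / s).
  rewrite lx -[in X in _ * (X * _)](powRr1 (ltW A0)) mulrACA -fD -powRD; last first.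
    by rewrite (gt_eqF A0) implybT.
  by congr (A `^ _ * f0 `^ _); field; lra.
have h3 := ler_wpM2l (powR_ge0 l (- s)) mA.
by rewrite h1; rewrite h2 in h3; lra.
Qed.

(** Jensen's inequality, by integrating the tangent inequality at the mean of
    |x|^s. *)
Lemma rmoment_powR_le nu k : 0 < s -> s <= 1 -> 1 < k -> finite_moments nu ->
  nu.-integrable setT (EFin \o (fun x : R => `|x| `^ k)) ->
  rmoment s nu `^ (k / s) <= rmoment k nu.
Proof.
move=> s0 s1 k1 [nu1 is_ _] ik.
have q1 : 1 < k / s by rewrite ltr_pdivlMr// mul1r; lra.
set q := k / s in q1 *; set m := rmoment s nu.
have m0 : 0 <= m by exact: rmoment_ge0.
have i1 := integrableZl measurableT (q * m `^ (q - 1)) is_.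
have i2 : nu.-integrable setT (EFin \o (fun _ : R => (q - 1) * m `^ q)).
  exact: finite_measure_integrable_cst.
have : \int[nu]_x (q * m `^ (q - 1) * `|x| `^ s - (q - 1) * m `^ q) <= rmoment k nu.
  apply: le_Rintegral => //; first exact: (integrableB measurableT i1 i2).
  move=> x _; have := powR_tangent q1 (powR_ge0 `|x| s) m0.
  by rewrite -powRrM (_ : s * q = k)//; rewrite /q; field; lra.
rewrite (RintegralB measurableT i1 i2) (RintegralZl _ measurableT is_).
rewrite (Rintegral_cst nu measurableT).
have -> : fine (nu setT) = 1 by rewrite nu1.
rewrite -/(rmoment s nu) -/m mulr1.
have q0 : 0 < q by lra.
have := mulr_powRB1 m0 q0.
set X := m `^ (q - 1); set Y := m `^ q => e h.
have e2 : q * X * m = q * Y by rewrite -e; ring.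
by rewrite e2 in h; lra.
Qed.

End MeansOfProfiles.

Section ExtendedMoments.
Context {R : realType}.
Implicit Types (nu : borel_measure R) (p : R).

Lemma momentE nu p :
  nu.-integrable setT (EFin \o (fun x : R => `|x| `^ p)) ->
  moment p nu = (rmoment p nu)%:E.
Proof.
move=> ip; rewrite /moment /rmoment /Rintegral fineK//.
exact: integrable_fin_num ip.
Qed.

Lemma integrable_of_moment_lty nu p : 0 < p -> (moment p nu < +oo)%E ->
  nu.-integrable setT (EFin \o (fun x : R => `|x| `^ p)).
Proof.
move=> p0 fin_p; apply/integrableP; split.
  by apply/measurable_EFinP; exact: measurable_powR_norm.
apply: le_lt_trans fin_p; rewrite le_eqVlt; apply/orP; left; apply/eqP.
by apply: eq_integral => x _ /=; rewrite ger0_norm// powR_ge0.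
Qed.

End ExtendedMoments.

(** * Decay of the moment of order s *)

Section MomentDecay.
Context {R : realType} (a s gamma : R).
Implicit Types (nu : borel_measure R) (mu : R -> borel_measure R) (b m p t w : R).

Definition solution nu mu :=
  [/\ measure_weak_solution a gamma nu mu, finite_moments s gamma nu &
      forall t, 0 <= t -> finite_moments s gamma (mu t)].

(** The moment may be much larger than m at time t1: it is only asked to stay
    above a fraction of m.  The profile is T_L + T_n.  The level L is chosen
    with L^s proportional to m, so that as long as the average of the profile
    stays below m the production absorbs the large particles; then the average
    decreases at most at the speed m^(1 + gamma / s) dictated by scaling.  The
    level n is only there to capture the mass of the moment at time t1. *)
Lemma moment_persistence : 0 < a -> a < 1 -> 0 < s -> s <= 1 -> 1 < gamma ->
  exists2 c0, 0 < c0 & forall nu mu, solution nu mu ->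
    forall m t1 t2, 0 < m -> 0 <= t1 -> t1 <= t2 ->
    m < rmoment s (mu t1) -> t2 - t1 <= c0 * m `^ (- (gamma / s)) ->
    m / 4 <= rmoment s (mu t2).
Proof.
move=> a0 a1 s0 s1 g1.
have sg : s < gamma by lra.
have ga0 : 0 < gamma by lra.
pose mn := Num.min a (1 - a).
have mn0 : 0 < mn by rewrite lt_min a0; lra.
pose c : R := 2 `^ (- gamma); have c0 : 0 < c by rewrite powR_gt0.
pose C : R := 6 * 2 `^ gamma; have C0 : 0 < C by rewrite mulr_gt0// powR_gt0.
pose q := C / c; have q0 : 0 < q by rewrite divr_gt0.
pose p := gamma / s; have p1 : 1 < p by rewrite ltr_pdivlMr// mul1r.
pose K1 := mn `^ (- s) * (mn^-1 `^ (gamma - s) * q `^ (p - 1)).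
have K10 : 0 < K1 by rewrite !mulr_gt0 ?powR_gt0// invr_gt0.
pose K0 := C * K1; have K00 : 0 < K0 by rewrite mulr_gt0.
exists (2 * K0)^-1; first by rewrite invr_gt0 mulr_gt0.
move=> nu mu [sol fm0 fm] m t1 t2 m0 t10 t12 mf1 t21; rewrite -/p in t21.
have t20 := le_trans t10 t12.
have e0 : 0 < rmoment s (mu t1) - m by rewrite subr_gt0.
have [n n0 Hn] := trunc_mean_approx s0 s1 sg (fm _ t10) e0.
rewrite subKr in Hn.
have qm0 : 0 < q * m by rewrite mulr_gt0.
pose L := (q * m) `^ s^-1; have L0 : 0 < L by rewrite powR_gt0.
have Ls : L `^ s = q * m by rewrite -powRrM mulVf ?powRr1 ?(ltW qm0)//; lra.
have tL := test_profile_trunc_pow s0 s1 (ltW L0).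
have tn := test_profile_trunc_pow s0 s1 (ltW n0).
have tg := test_profileD tL tn.
set g := trunc_pow s L \+ trunc_pow s n in tg.
pose I t := pmean g (mu t).
have eI t : I t = pmean (trunc_pow s L) (mu t) + pmean (trunc_pow s n) (mu t).
  exact: pmeanD.
have I1 : m <= I t1.
  by rewrite eI; apply: (le_trans Hn); rewrite lerDr; exact: pmean_ge0.
have I2 : I t2 <= 2 * rmoment s (mu t2).
  apply: pmean_le_rmoment => //; first exact: fm.
  move=> r r0 /=; rewrite mulr_natl mulr2n.
  by apply: lerD; apply: trunc_pow_le => //; exact: ltW.
(* The coefficient of pow_le_trunc_gain, homogeneous of degree p - 1 in m. *)
have kappa : mn `^ (- s) * (L / mn) `^ (gamma - s) = K1 * m `^ (p - 1).
  rewrite powRM ?invr_ge0 ?(ltW L0) ?(ltW mn0)// -powRrM.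
  have -> : s^-1 * (gamma - s) = p - 1 by rewrite /p; field; lra.
  rewrite powRM ?(ltW q0) ?(ltW m0)// /K1.
  by ring.
have bc : bounded_continuous (fun x => g `|x|).
  exact: bounded_continuous_test_profile.
have K20 : 0 <= K0 * m `^ (p - 1) * m ^+ 2.
  by rewrite !mulr_ge0 ?powR_ge0 ?sqr_ge0// ltW.
have bar : m - K0 * m `^ (p - 1) * m ^+ 2 * (t2 - t1) <= I t2.
  apply: (@barrier _ I) => //.
    have := mean_continuous sol bc t20.
    apply: continuous_subspaceW => x /=; rewrite !in_itv/= => /andP[t1x ->].
    by rewrite (le_trans t10 t1x).
  move=> u v t1u uv vt2 Im.
  have u0 := le_trans t10 t1u.
  apply: (mean_increment_ge sol bc u0 uv) => tau utau tauv.
  have tau0 := le_trans u0 utau.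
  have fmt := fm _ tau0.
  have It0 : 0 <= I tau by exact: pmean_ge0.
  have Itm := Im _ utau tauv.
  have Pn0 := pmean_ge0 (mu tau) tn.
  have Gn0 := gain_moment_ge0 gamma (mu tau) a0 a1 tn.
  have ME : rmoment gamma (mu tau) <=
      K1 * m `^ (p - 1) * I tau + L `^ (- s) * gain_moment a gamma g (mu tau).
    have := rmoment_le_trunc_gain a0 a1 s0 s1 sg L0 fmt.
    rewrite -/mn kappa => /le_trans; apply; apply: lerD; apply: ler_wpM2l.
    - by rewrite mulr_ge0 ?powR_ge0// ltW.
    - by rewrite eI lerDl.
    - exact: powR_ge0.
    - by rewrite (gain_momentD a0 a1 ga0 fmt)// lerDl.
  (* This condition is what fixes L `^ s = (C / c) * m. *)
have Id : C * I tau * L `^ (- s) <= c.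
    rewrite powRN Ls ler_pdivrMr//.
    have -> : c * (q * m) = C * m by rewrite /q; field; exact: lt0r_neq0.
    by rewrite ler_wpM2l// ltW.
  have := collision_ge_controlled a0 a1 ga0 fmt tg ME Id.
  apply: le_trans; rewrite lerN2 -/C /K0.
  have II : I tau * I tau <= m ^+ 2 by rewrite expr2; exact: (ler_pM It0 It0 Itm Itm).
  have := ler_wpM2l (mulr_ge0 (mulr_ge0 (ltW C0) (ltW K10)) (powR_ge0 m (p - 1))) II.
  by rewrite /I; lra.
have small : K0 * m `^ (p - 1) * m ^+ 2 * (t2 - t1) <= m / 2.
  apply: le_trans (ler_wpM2l K20 t21) _.
  have mp := mulr_powRB1 (ltW m0) (_ : 0 < p).
  have -> : K0 * m `^ (p - 1) * m ^+ 2 * ((2 * K0)^-1 * m `^ (- p)) =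
     K0 * (2 * K0)^-1 * m * ((m * m `^ (p - 1)) * m `^ (- p)) by ring.
  rewrite mp; last by lra.
  rewrite powRN mulfV ?gt_eqF ?powR_gt0// le_eqVlt; apply/orP; left; apply/eqP.
  by field; exact: lt0r_neq0.
by lra.
Qed.

(** The weak formulation identifies averages of bounded profiles only, hence the
    passage through truncations. *)
Lemma rmoment_at0 nu mu : 0 < s -> s <= 1 -> s < gamma ->
  solution nu mu -> rmoment s (mu 0) = rmoment s nu.
Proof.
move=> s0 s1 sg [sol fm0 fm].
have eT L : 0 < L -> pmean (trunc_pow s L) (mu 0) = pmean (trunc_pow s L) nu.
  move=> L0; apply: (mean_at0 sol); apply: bounded_continuous_test_profile.
  exact: test_profile_trunc_pow (ltW L0).
have Tle nu' L : 0 < L -> finite_moments s gamma nu' ->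
    pmean (trunc_pow s L) nu' <= rmoment s nu'.
  move=> L0 fm'; rewrite -[leRHS]mul1r; apply: pmean_le_rmoment fm' _ _.
    exact: test_profile_trunc_pow (ltW L0).
  by move=> r r0; rewrite mul1r; apply: trunc_pow_le => //; exact: ltW.
apply/eqP; rewrite eq_le; apply/andP; split; apply/ler_addgt0Pr => e e0.
  have [L L0 HL] := trunc_mean_approx s0 s1 sg (fm _ (lexx 0)) e0.
  by have := Tle _ _ L0 fm0; rewrite -eT//; lra.
have [L L0 HL] := trunc_mean_approx s0 s1 sg fm0 e0.
by have := Tle _ _ L0 (fm _ (lexx 0)); rewrite eT//; lra.
Qed.

(** Let f0 be the initial moment and suppose f(t) < f0; persistence then keeps f
    below 5 f0 on [0, t].  Take L = t^(-1 / gamma), the size that a particle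
    reaches by fragmentation during the time t, and let E be the defect of the
    cap at the matching level, which controls the moment of order gamma up to
    a production term.  With lam proportional to f0 L^(-s), the profiles
    T_n + lam T_L and cap + S lam T_L decrease at most at the speed f0 sup E.
    Using the first on [tau, t] and the second on [0, tau], the
    contributions of T_L telescope to the increment of its average J over
    [0, t], which is at most f0 - J(0) because f(t) < f0.  The outcome is
    E(tau) <= D B + (sup E) / 2, hence sup E <= 2 D B, and the first profile on
    [0, t] gives the conclusion. *)
Lemma moment_short_time : 0 < a -> a < 1 -> 0 < s -> s <= 1 -> 1 < gamma ->
  exists c1 C1, [/\ 0 < c1, 0 < C1 & forall nu mu, solution nu mu ->
    forall B t, 0 < rmoment s nu -> rmoment gamma nu <= B -> 0 < t ->
    t <= c1 * rmoment s nu `^ (- (gamma / s)) ->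
    rmoment s nu * (1 - C1 * B * t) <= rmoment s (mu t)].
Proof.
move=> a0 a1 s0 s1 g1.
have sg : s < gamma by lra.
have ga0 : 0 < gamma by lra.
have [c0 c00 pers] := moment_persistence a0 a1 s0 s1 g1.
pose mn := Num.min a (1 - a).
have mn0 : 0 < mn by rewrite lt_min a0; lra.
pose c : R := 2 `^ (- gamma); have c_gt0 : 0 < c by rewrite powR_gt0.
pose C : R := 6 * 2 `^ gamma; have C0 : 0 < C by rewrite mulr_gt0// powR_gt0.
pose q := C / c; have q0 : 0 < q by rewrite divr_gt0.
pose p := gamma / s; have p1 : 1 < p by rewrite ltr_pdivlMr// mul1r.
have p0 : 0 < p by lra.
pose M := mn^-1 `^ (gamma - s).
have M0 : 0 < M by rewrite powR_gt0// invr_gt0.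
pose D := p * (1 + M); have D0 : 0 < D by rewrite mulr_gt0//; lra.
have CpM0 : 0 < C * p * M := mulr_gt0 (mulr_gt0 C0 p0) M0.
have [eps [eps0 epsq epsC]] : exists eps : R,
    [/\ 0 < eps, 10 * q * eps <= 1 & 10 * (C * p * M) * eps <= 1 / 2].
  exists (10 * q + 20 * (C * p * M))^-1; split.
  - by rewrite invr_gt0; lra.
  - by rewrite ler_pdivrMr ?mul1r; lra.
  - by rewrite ler_pdivrMr; lra.
exists (Num.min (c0 * 5 `^ (- p)) (eps `^ p)), (10 * q + 20 * (C * D)).
split.
- by rewrite lt_min mulr_gt0 ?powR_gt0//; lra.
- by have : 0 < C * D := mulr_gt0 C0 D0; lra.
move=> nu mu soln; have [sol fm0 fm] := soln => B t f00 MB t0.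
rewrite -/p => tc1.
set f0 := rmoment s nu in f00 tc1 *.
pose f tau := rmoment s (mu tau).
have ef0 : f 0 = f0 by exact: rmoment_at0.
have B0 : 0 <= B by exact: le_trans (rmoment_ge0 _ _) MB.
have CB0 : 0 <= (10 * q + 20 * (C * D)) * B * t.
  rewrite mulr_ge0 ?(ltW t0)// mulr_ge0//.
  by have : 0 < C * D := mulr_gt0 C0 D0; lra.
have [ft_ge|ft_lt] := leP f0 (f t).
  apply: le_trans ft_ge; rewrite -[leRHS]mulr1 ler_wpM2l// ?(ltW f00)//.
  by lra.
(* A value above 5 f0 would persist above 5 f0 / 4 until time t. *)
have f5 tau : 0 <= tau -> tau <= t -> f tau <= 5 * f0.
  move=> tau0 taut; rewrite leNgt; apply/negP => f5.
  have f50 : 0 < 5 * f0 by lra.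
  have := pers nu mu soln (5 * f0) tau t f50 tau0 taut f5.
  have -> : t - tau <= c0 * (5 * f0) `^ (- (gamma / s)).
    apply: (@le_trans _ _ t); first by lra.
    apply: (le_trans tc1); rewrite -/p powRM ?(ltW f00)// mulrA.
    by rewrite ler_wpM2r ?powR_ge0// ge_min lexx.
  by move=> /(_ isT); rewrite -/(f t); lra.
(* L has gamma-th power 1 / t, so that eta = f0 t^(1 / p) is small. *)
pose L := t `^ (- gamma^-1).
have L0 : 0 < L by rewrite powR_gt0.
have Lg : L `^ (- gamma) = t.
  by rewrite -powRrM mulrNN mulVf ?powRr1 ?(ltW t0)//; lra.
have Lmul x y : L `^ x * L `^ y = L `^ (x + y).
  by rewrite powRD// (gt_eqF L0) implybT.
pose eta := f0 * L `^ (- s).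
have eta0 : 0 < eta by rewrite mulr_gt0// powR_gt0.
have etae : eta <= eps.
  have Ls : L `^ (- s) = t `^ p^-1.
    by rewrite -powRrM mulrNN /p invf_div mulrC.
  rewrite /eta Ls mulrC -ler_pdivlMr//.
  have tp : t <= (eps / f0) `^ p.
    apply: (le_trans tc1); rewrite powRM ?invr_ge0 ?(ltW eps0) ?(ltW f00)//.
    have -> : f0 `^ (- p) = f0^-1 `^ p.
      by rewrite -(powR_inv1 (ltW f00)) -powRrM mulN1r.
    by rewrite ler_wpM2r ?powR_ge0// ge_min lexx orbT.
  have -> : eps / f0 = ((eps / f0) `^ p) `^ p^-1.
    by rewrite -powRrM mulfV ?powRr1 ?divr_ge0 ?(ltW eps0) ?(ltW f00)//; lra.
  by apply: ler_powR_base; rewrite ?invr_ge0 ?(ltW t0) ?(ltW p0).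
pose lam := 10 * q * eta.
have lam0 : 0 < lam by rewrite mulr_gt0// mulr_gt0.
have lam1 : lam <= 1.
  by apply: le_trans epsq; rewrite ler_wpM2l// mulr_ge0// ltW.
pose U := L / mn; have U0 : 0 <= U by rewrite divr_ge0// ltW.
pose S := gamma / s * U `^ (gamma - s).
have eS : S = p * M * L `^ (gamma - s).
  rewrite /S /U powRM ?invr_ge0 ?(ltW L0) ?(ltW mn0)// -/p -/M.
  by ring.
have S0 : 0 < S by rewrite eS mulr_gt0 ?powR_gt0// mulr_gt0.
have tk := test_profile_cap s0 s1 g1 U0.
have tL := test_profile_trunc_pow s0 s1 (ltW L0).
pose k := cap_profile s gamma U.
pose J tau := pmean (trunc_pow s L) (mu tau).
pose E tau := cap_defect s gamma U (mu tau).
have kle r : 0 <= r -> k r <= S * r `^ s by move=> r0; exact: cap_profile_le.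
have Tle r : 0 <= r -> trunc_pow s L r <= r `^ s.
  by move=> r0; apply: trunc_pow_le => //; exact: ltW.
(* A bound e on the defects controls the decrease of the average of any profile
   g below sig r^s, once it is corrected by the multiple sig lam of T_L that
   pays for the large particles. *)
have drift g sig e u v : 0 < sig -> test_profile g ->
    (forall r, 0 <= r -> g r <= sig * r `^ s) -> 0 <= e ->
    (forall tau, 0 <= tau -> tau <= t -> E tau <= e) ->
    0 <= u -> u <= v -> v <= t ->
    pmean g (mu u) + sig * lam * J u - C * e * (10 * sig * f0) * (v - u) <=
    pmean g (mu v) + sig * lam * J v.
  move=> sig0 tg gs e0 Ee u0 uv vt.
  have sl0 : 0 <= sig * lam by rewrite mulr_ge0// ltW.
  have th := test_profileZ sl0 tL.
  have tgh := test_profileD tg th.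
  have eI tau : pmean (g \+ (fun r => sig * lam * trunc_pow s L r)) (mu tau) =
      pmean g (mu tau) + sig * lam * J tau.
    by rewrite pmeanD// pmeanZ.
  rewrite -!eI.
  have bc := bounded_continuous_test_profile tgh.
  apply: (mean_increment_ge sol bc u0 uv) => tau utau tauv.
  have tau0 := le_trans u0 utau; have taut := le_trans tauv vt.
  have fmt := fm _ tau0.
  have I10 : pmean (g \+ (fun r => sig * lam * trunc_pow s L r)) (mu tau)
      <= 10 * sig * f0.
    apply: (@le_trans _ _ (2 * sig * f tau)).
      apply: (pmean_le_rmoment fmt tgh) => r r0 /=.
      have h1 := gs r r0.
      have h2 : sig * lam * trunc_pow s L r <= sig * 1 * r `^ s.
        apply: ler_pM => //; first by exact: powR_ge0.
          by rewrite ler_wpM2l// ltW.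
        exact: Tle.
      by lra.
    have -> : 10 * sig * f0 = 2 * sig * (5 * f0) by ring.
    by rewrite ler_wpM2l ?f5// mulr_ge0// ltW.
  have ME : rmoment gamma (mu tau) <= e + L `^ (- s) / (sig * lam) *
      gain_moment a gamma (g \+ (fun r => sig * lam * trunc_pow s L r)) (mu tau).
    have h := rmoment_le_cap_gain a0 a1 s0 s1 g1 L0 fmt.
    apply: (le_trans h); apply: lerD; first exact: Ee.
    rewrite (gain_momentD a0 a1 ga0 fmt)// (gain_momentZ _ a0 a1 ga0 fmt)//.
    rewrite mulrDr mulrA divfK; last by rewrite gt_eqF// mulr_gt0.
    by rewrite lerDr mulr_ge0 ?divr_ge0 ?powR_ge0 ?gain_moment_ge0.
  have Id : C * pmean (g \+ (fun r => sig * lam * trunc_pow s L r)) (mu tau) *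
      (L `^ (- s) / (sig * lam)) <= c.
    apply: (@le_trans _ _ (C * (10 * sig * f0) * (L `^ (- s) / (sig * lam)))).
      by rewrite ler_wpM2r ?divr_ge0 ?powR_ge0// ler_wpM2l// ltW.
    rewrite /lam /eta /q le_eqVlt; apply/orP; left; apply/eqP.
    by field; rewrite ?gt_eqF ?powR_gt0.
  have := collision_ge_controlled a0 a1 ga0 fmt tgh ME Id.
  apply: le_trans; rewrite lerN2 -/C.
  by rewrite ler_wpM2l// mulr_ge0// ltW.
have Jf tau : 0 <= tau -> J tau <= f tau.
  move=> tau0; rewrite -[leRHS]mul1r; apply: (pmean_le_rmoment (fm _ tau0) tL).
  by move=> r r0; rewrite mul1r Tle.
have ek0 : pmean k (mu 0) = pmean k nu.
  by apply: (mean_at0 sol); exact: bounded_continuous_test_profile.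
have eJ0 : J 0 = pmean (trunc_pow s L) nu.
  by apply: (mean_at0 sol); exact: bounded_continuous_test_profile.
have capB : S * f0 - pmean k (mu 0) <= p * B.
  rewrite ek0; apply: (le_trans (cap_defect_ub s0 s1 g1 U0 fm0)).
  by rewrite -/p ler_wpM2l// ltW.
have truncB : f0 - J 0 <= L `^ (s - gamma) * B.
  rewrite eJ0; apply: (le_trans (trunc_mean_defect s0 s1 sg L0 fm0)).
  by rewrite ler_wpM2l// powR_ge0.
have E_ge0 tau : 0 <= tau -> 0 <= E tau.
  by move=> tau0; rewrite subr_ge0; exact: (pmean_le_rmoment (fm _ tau0) tk).
have E_ub tau : 0 <= tau -> tau <= t -> E tau <= S * (5 * f0).
  move=> tau0 taut; apply: (@le_trans _ _ (S * f tau)).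
    by rewrite /E /cap_defect gerBl; exact: pmean_ge0.
  by rewrite ler_wpM2l ?f5// ltW.
have t_ge0 := ltW t0.
pose A := [set x | exists2 tau, 0 <= tau <= t & x = E tau].
have A0 : A (E 0) by exists 0; rewrite ?lexx.
have supA : has_sup A.
  split; first by exists (E 0).
  by exists (S * (5 * f0)) => x [tau /andP[tau0 taut] ->]; exact: E_ub.
pose e := sup A.
have Ee tau : 0 <= tau -> tau <= t -> E tau <= e.
  move=> tau0 taut; apply: ub_le_sup; first exact: supA.2.
  by exists tau; rewrite ?tau0.
have e0 : 0 <= e := le_trans (E_ge0 0 (lexx 0)) (Ee 0 (lexx 0) t_ge0).
(* The case g = T_n of the drift estimate, with n tending to infinity. *)
have fdrift tau : 0 <= tau -> tau <= t ->
    f tau + lam * J tau - C * e * (10 * f0) * (t - tau) <= f t + lam * J t.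
  move=> tau0 taut; apply/ler_addgt0Pr => x x0.
  have [n n0 Hn] := trunc_mean_approx s0 s1 sg (fm _ tau0) x0.
  have tn := test_profile_trunc_pow s0 s1 (ltW n0).
  have nle r : 0 <= r -> trunc_pow s n r <= 1 * r `^ s.
    by move=> r0; rewrite mul1r; apply: trunc_pow_le => //; exact: ltW.
  have h1 := drift _ 1 e tau t ltr01 tn nle e0 Ee tau0 taut (lexx t).
  have h2 := pmean_le_rmoment (fm _ t_ge0) tn nle.
  rewrite !mul1r mulr1 in h1 h2; rewrite -/(f t) in h2; rewrite -/(f tau) in Hn.
  by lra.
have lamL : lam * L `^ (s - gamma) = 10 * q * f0 * t.
  rewrite /lam /eta -!mulrA Lmul (_ : - s + (s - gamma) = - gamma) ?Lg//.
  by ring.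
have SL : S * L `^ (s - gamma) = p * M.
  rewrite eS -!mulrA Lmul (_ : gamma - s + (s - gamma) = 0) ?powRr0 ?mulr1//.
  by ring.
have Sft : S * f0 * t = p * M * eta.
  rewrite eS -[in LHS]Lg /eta.
  have -> : p * M * L `^ (gamma - s) * f0 * L `^ (- gamma) =
      p * M * (f0 * (L `^ (gamma - s) * L `^ (- gamma))) by ring.
  rewrite Lmul (_ : gamma - s - gamma = - s)//.
  by ring.
have Jdiff : J t - J 0 <= L `^ (s - gamma) * B.
  by have := Jf t t_ge0; lra.
(* The drift of the cap on [0, tau] and S times that of the moment on
   [tau, t]: the terms in J tau cancel. *)
have Emain tau : 0 <= tau -> tau <= t -> E tau <= D * B + e / 2.
  move=> tau0 taut.
  have h1 := drift _ S e 0 tau S0 tk kle e0 Ee (lexx 0) tau0 taut.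
  have h2 := ler_wpM2l (ltW S0) (fdrift tau tau0 taut).
  have h3 : S * lam * (J t - J 0) <= p * M * B.
    apply: (@le_trans _ _ (S * lam * (L `^ (s - gamma) * B))).
      by rewrite ler_wpM2l// mulr_ge0// ltW.
    have -> : S * lam * (L `^ (s - gamma) * B) =
      lam * (S * L `^ (s - gamma) * B) by ring.
    by rewrite SL ler_piMl// mulr_ge0// mulr_ge0// ltW.
  have h4 : 10 * C * e * (S * f0 * t) <= e / 2.
    rewrite Sft.
    have -> : 10 * C * e * (p * M * eta) = 10 * (C * p * M) * eta * e by ring.
    have -> : e / 2 = 1 / 2 * e by ring.
    rewrite ler_wpM2r//; apply: le_trans epsC; rewrite ler_wpM2l//.
    by rewrite mulr_ge0// ltW.
  have h5 : S * f t <= S * f0 by rewrite ler_wpM2l// ltW.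
  have eE : E tau = S * f tau - pmean k (mu tau) by [].
  rewrite eE /D; rewrite -/k in h1.
  by lra.
have eDB : e <= 2 * D * B.
  have : e <= D * B + e / 2.
    apply: ge_sup; first by exists (E 0).
    by move=> x [tau /andP[tau0 taut] ->]; exact: Emain.
  by lra.
have h1 := fdrift 0 (lexx 0) t_ge0; rewrite ef0 subr0 in h1.
have h2 : lam * (J t - J 0) <= 10 * q * f0 * t * B.
  by rewrite -lamL -mulrA ler_wpM2l// ltW.
have h3 : C * e * (10 * f0) * t <= C * (2 * D * B) * (10 * f0) * t.
  by rewrite ler_wpM2r// ler_wpM2r ?mulr_ge0 ?(ltW f00)// ler_wpM2l// ltW.
by rewrite -/(f t); lra.
Qed.

Lemma solution_of_weak nu mu : 0 < s -> s <= 1 -> 1 < gamma ->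
  in_P0 (Upsilon gamma) nu -> measure_weak_solution a gamma nu mu ->
  solution nu mu.
Proof.
move=> s0 s1 g1 [nu1 _ _] sol; have [[nuU muU] _ mass _] := sol.
have gU : gamma <= Upsilon gamma by rewrite /Upsilon le_max lexx.
have sU : s <= Upsilon gamma by apply: le_trans gU; lra.
have ga0 : 0 < gamma by lra.
split=> //.
  by split; [|exact: integrable_powR_norm nuU|exact: integrable_powR_norm nuU].
move=> t t0; split; last 2 first.
- exact: integrable_powR_norm (muU _ t0).
- exact: integrable_powR_norm (muU _ t0).
have [->|tn0] := eqVneq t 0; last first.
  have tp : 0 < t by rewrite lt0r tn0.
  by have [-> _] := mass t tp.
have bc1 : bounded_continuous (fun _ : R => 1 : R).
  split; first by move=> x; exact: cvg_cst.
  exists 1; split; first exact: num_real.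
  by move=> N N1 x _ /=; rewrite normr1 ltW.
have := mean_at0 sol bc1.
rewrite !Rintegral_cst// !mul1r.
have -> : fine (nu setT) = 1 by rewrite nu1.
have fin0 : mu 0 setT \is a fin_num by exact: fin_num_measure.
by move=> h; rewrite -(fineK fin0) h.
Qed.

(** The tangent inequality at the p-th root of w, evaluated at 1 and divided by
    p w. *)
Lemma inv_root_le_tangent p w : 1 < p -> 0 < w ->
  w `^ (- p^-1) <= 1 - p^-1 * (1 - w^-1).
Proof.
move=> p1 w0; have p0 : 0 < p by lra.
have := powR_tangent p1 ler01 (powR_ge0 w p^-1).
rewrite -!powRrM mulVf ?powRr1 ?(ltW w0) ?gt_eqF// powR1 mulr1.
have -> : p^-1 * (p - 1) = 1 - p^-1 by field; exact: lt0r_neq0.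
rewrite powRD ?(gt_eqF w0) ?implybT// powRr1 ?(ltW w0)//.
set X := w `^ _ => h.
have h2 : (p * w) * X <= (p * w) * (1 - p^-1 * (1 - w^-1)).
  have -> : (p * w) * (1 - p^-1 * (1 - w^-1)) = 1 + (p - 1) * w.
    by field; rewrite !lt0r_neq0.
  by lra.
by rewrite ler_pM2l ?mulr_gt0 in h2.
Qed.

(** In terms of w = 1 + C p b t, the short time estimate applies while w <= 5^p.
    For w > 5^p persistence is used between 0 and t with m equal to four times
    the claimed bound; then m is less than the initial moment, and the time
    allowed by persistence is proportional to w, hence at least t if C is
    large.  The three summands of C are what these requirements ask for. *)
Lemma moment_lower_bound : 0 < a -> a < 1 -> 0 < s -> s <= 1 -> 1 < gamma ->
  exists2 C, 0 < C & forall nu mu, solution nu mu ->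
    forall b t, 0 < rmoment s nu -> rmoment s nu `^ (gamma / s) <= b ->
    rmoment gamma nu <= 2 * b -> 0 <= t ->
    rmoment s nu * (1 + C * (gamma / s) * b * t) `^ (- (s / gamma))
    <= rmoment s (mu t).
Proof.
move=> a0 a1 s0 s1 g1; have sg : s < gamma by lra.
have [c0 c00 pers] := moment_persistence a0 a1 s0 s1 g1.
have [c1 [C1 [c10 C10 short]]] := moment_short_time a0 a1 s0 s1 g1.
have p1 : 1 < gamma / s by rewrite ltr_pdivlMr// mul1r.
have -> : s / gamma = (gamma / s)^-1 by rewrite invf_div.
set p := gamma / s in p1 *; have p0 : 0 < p by lra.
pose K : R := 5 `^ p; have K0 : 0 < K by rewrite powR_gt0//; lra.
have F0 : 0 < 4 `^ p :> R by rewrite powR_gt0//; lra.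
pose E1 := 2 * C1 * K; pose E2 := K / (p * c1); pose E3 := 4 `^ p / (p * c0).
have e10 : 0 < E1 by rewrite mulr_gt0// mulr_gt0.
have e20 : 0 < E2 by rewrite divr_gt0// mulr_gt0.
have e30 : 0 < E3 by rewrite divr_gt0// mulr_gt0.
pose C := E1 + E2 + E3.
have C_1 : E1 <= C by rewrite /C; lra.
have C_2 : K <= C * p * c1.
  have : E2 <= C by rewrite /C; lra.
  by rewrite /E2 ler_pdivrMr ?(mulr_gt0 p0)// mulrA.
have C_3 : 4 `^ p <= C * p * c0.
  have : E3 <= C by rewrite /C; lra.
  by rewrite /E3 ler_pdivrMr ?(mulr_gt0 p0)// mulrA.
have C0 : 0 < C by rewrite /C; lra.
have Cp0 : 0 < C * p := mulr_gt0 C0 p0.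
clearbody C.
exists C => // nu mu sol b t f00 fb Mb t0.
set f0 := rmoment s nu in f00 fb *.
have ef0 : rmoment s (mu 0) = f0 := rmoment_at0 s0 s1 sg sol.
have fp0 : 0 < f0 `^ p by rewrite powR_gt0.
have b0 : 0 < b by exact: lt_le_trans fb.
have z0 : 0 <= b * t by rewrite mulr_ge0// ltW.
have Cpz0 : 0 <= C * p * b * t by rewrite -mulrA mulr_ge0// ltW.
set w := 1 + C * p * b * t.
have w1 : 1 <= w by rewrite /w; lra.
have w0 : 0 < w by lra.
have [wK|Kw] := leP w K.
  have [t_0|tn0] := eqVneq t 0.
    by rewrite /w t_0 mulr0 addr0 powR1 mulr1 ef0.
  have tp : 0 < t by rewrite lt0r tn0.
  have tc1 : t <= c1 * f0 `^ (- p).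
    rewrite powRN ler_pdivlMr//.
    have h1 : C * p * (f0 `^ p * t) <= C * p * (b * t).
      by rewrite ler_wpM2l ?ler_wpM2r// ltW.
    have h2 : C * p * (t * f0 `^ p) <= C * p * c1.
      by rewrite /w in wK; rewrite mulrC; lra.
    by move: h2; rewrite ler_pM2l.
  apply: le_trans (short nu mu sol (2 * b) t f00 Mb tp tc1).
  rewrite ler_wpM2l ?(ltW f00)//.
  apply: (le_trans (inv_root_le_tangent p1 w0)).
  have -> : p^-1 * (1 - w^-1) = C * (b * t) / w.
    by rewrite /w; field; rewrite !lt0r_neq0.
  rewrite lerB//.
  have h3 : C1 * (2 * b) * t * w <= C * (b * t).
    apply: (@le_trans _ _ (2 * C1 * K * (b * t))); last by rewrite ler_wpM2r.
    have -> : C1 * (2 * b) * t * w = 2 * C1 * (b * t) * w by ring.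
    have -> : 2 * C1 * K * (b * t) = 2 * C1 * (b * t) * K by ring.
    by rewrite ler_wpM2l// mulr_ge0// mulr_ge0// ltW.
  by rewrite ler_pdivlMr.
have wp0 : 0 < w `^ (- p^-1) by rewrite powR_gt0.
have m0 : 0 < 4 * f0 * w `^ (- p^-1) by rewrite mulr_gt0// mulr_gt0.
have mf : 4 * f0 * w `^ (- p^-1) < rmoment s (mu 0).
  rewrite ef0 powRN ltr_pdivrMr ?powR_gt0// mulrC ltr_pM2l//.
  have : 5 <= w `^ p^-1.
    have -> : 5 = K `^ p^-1 :> R.
      by rewrite /K -powRrM mulfV ?powRr1//; lra.
    by apply: ler_powR_base; [rewrite invr_ge0 ltW|exact: ltW|exact: ltW].
  by lra.
have tc0 : t - 0 <= c0 * (4 * f0 * w `^ (- p^-1)) `^ (- p).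
  rewrite subr0 powRM ?(ltW wp0)//; last by rewrite mulr_ge0// ltW.
  rewrite powRM ?(ltW f00)// -powRrM mulrNN mulVf ?powRr1 ?(ltW w0)//; last by lra.
  rewrite !powRN.
  have h1 : 4 `^ p * f0 `^ p * t <= c0 * w.
    have h2 : 4 `^ p * (f0 `^ p * t) <= C * p * c0 * (b * t).
      by apply: ler_pM => //; rewrite ?mulr_ge0 ?ler_wpM2r// ltW.
    have h3 : c0 * (C * p * b * t) <= c0 * w.
      by rewrite ler_wpM2l ?(ltW c00)// /w; lra.
    by lra.
  have -> : c0 * ((4 `^ p)^-1 * (f0 `^ p)^-1 * w) = c0 * w / (4 `^ p * f0 `^ p).
    by field; rewrite !lt0r_neq0.
  by rewrite ler_pdivlMr ?mulr_gt0// mulrC.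
have := pers nu mu sol _ 0 t m0 (lexx 0) t0 mf tc0.
by lra.
Qed.

End MomentDecay.

(** * The lower bounds *)

Unset Implicit Arguments.

Theorem proposition3p4 (R : realType) (a gamma s : R)
    (ha0 : 0 < a) (ha1 : a < 1) (hgamma : 1 < gamma)
    (hs0 : 0 < s) (hs1 : s <= 1) :
  exists C Ct : R, [/\ 0 < C, 0 < Ct &
    forall (mu0 : borel_measure R) (mu : R -> borel_measure R),
      in_P0 (Upsilon gamma) mu0 ->
      measure_weak_solution a gamma mu0 mu ->
    forall A : R,
      (maxe Ct%:E
         (moment (s + gamma) mu0 / (moment s mu0 `^ (1 + gamma / s)))
       <= A%:E)%E ->
    let D (t : R) : \bar R :=
      (1 + (C * A `^ (1 - s / gamma) * (gamma / s))%:E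
           * (moment s mu0 `^ (gamma / s)) * t%:E)%E in
    (forall t : R, 0 <= t ->
       (moment s mu0 / (D t `^ (s / gamma)) <= moment s (mu t))%E) /\
    (forall k t : R, 1 < k -> 0 <= t ->
       ((moment s mu0 `^ (k / s)) / (D t `^ (k / gamma))
        <= moment k (mu t))%E)].
Proof.
have sg : s < gamma by lra.
have [C C0 lb] := moment_lower_bound ha0 ha1 hs0 hs1 hgamma.
exists C, 1; split=> // nu mu nuP wsol A.
have sol := solution_of_weak hs0 hs1 hgamma nuP wsol.
have [_ fm0 fm] := sol; have [_ is0 ig0] := fm0.
rewrite (momentE is0); set f0 := rmoment s nu.
rewrite ge_max !lee_fin => /andP[A1 ratio] D.
have f0_ge0 : 0 <= f0 by exact: rmoment_ge0.
have mom_ge0 p t : (0 <= moment p (mu t))%E.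
  by apply: integral_ge0 => x _; rewrite lee_fin powR_ge0.
have [f00|f0n] := eqVneq f0 0.
  split=> [t t0|k t k1 t0].
    by rewrite f00 mul0e.
  rewrite f00 poweR_EFin powR0 ?mul0e//.
  by rewrite gt_eqF// divr_gt0//; lra.
have f0_gt0 : 0 < f0 by rewrite lt0r f0n.
have A0 : 0 < A by lra.
pose b := A `^ (1 - s / gamma) * f0 `^ (gamma / s).
have ratio' : (moment (s + gamma) nu <= (A * f0 `^ (1 + gamma / s))%:E)%E.
  move: ratio; rewrite poweR_EFin inver gt_eqF ?powR_gt0// => ratio.
  by rewrite EFinM -lee_pdivrMr ?powR_gt0// inver gt_eqF ?powR_gt0.
have isg : nu.-integrable setT (EFin \o (fun x : R => `|x| `^ (s + gamma))).
  apply: integrable_of_moment_lty; first by lra.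
  exact: le_lt_trans ratio' (ltry _).
have Mb : rmoment gamma nu <= 2 * b.
  apply: moment_interp_bound => //.
  by rewrite -lee_fin -(momentE isg).
have b1 : f0 `^ (gamma / s) <= b.
  rewrite /b ler_peMl ?powR_ge0// -[leLHS](powRr0 A); apply: ler_powR => //.
  by rewrite subr_ge0 ler_pdivrMr ?mul1r; lra.
pose w t := 1 + C * (gamma / s) * b * t.
have w0 t : 0 <= t -> 0 < w t.
  move=> t0; rewrite ltr_wpDr// !mulr_ge0 ?powR_ge0 ?invr_ge0 ?(ltW C0) ?(ltW hs0)//.
  by lra.
have DE t : D t = (w t)%:E.
  rewrite /D poweR_EFin -!EFinM -EFinD /w /b; congr (_%:E).
  by ring.
have low t : 0 <= t -> f0 * w t `^ (- (s / gamma)) <= rmoment s (mu t).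
  by move=> t0; exact: (lb nu mu sol b t f0_gt0 b1 Mb t0).
split=> [t t0|k t k1 t0].
  have [_ is1 _] := fm t t0.
  rewrite DE poweR_EFin inver gt_eqF ?powR_gt0 ?w0// -EFinM (momentE is1) lee_fin.
  by rewrite -powRN; exact: low.
rewrite DE !poweR_EFin inver gt_eqF ?powR_gt0 ?w0// -EFinM.
have [fin_k|inf_k] := ltP (moment k (mu t)) (+oo)%E; last first.
  by apply: le_trans inf_k; rewrite leey.
have ik := integrable_of_moment_lty (lt_trans ltr01 k1) fin_k.
rewrite (momentE ik) lee_fin.
apply: le_trans (rmoment_powR_le hs0 hs1 k1 (fm t t0) ik).
have -> : f0 `^ (k / s) / w t `^ (k / gamma) =
    (f0 * w t `^ (- (s / gamma))) `^ (k / s).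
  rewrite powRM ?powR_ge0// -powRrM -powRN; congr (_ * _ `^ _).
  by field; lra.
apply: ler_powR_base; last exact: low.
  by rewrite divr_ge0//; lra.
by rewrite mulr_ge0// powR_ge0.
Qed.
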